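(* Let $\theta\in\mathbb R\setminus\mathbb Q$ and let $\Gamma$ be one of the cyclic subgroups $\mathbb Z_3,\mathbb Z_4,\mathbb Z_6$ of $SL(2,\mathbb Z)$ described in the context. Then the periodic cyclic cohomology of $\mathcal A_\theta^{alg}\rtimes\Gamma$ satisfies $HP^{even}(\mathcal A_\theta^{alg}\rtimes\Gamma)\cong\mathbb C^8$ for $\Gamma=\mathbb Z_3$, $\cong\mathbb C^9$ for $\Gamma=\mathbb Z_4$, $\cong\mathbb C^{10}$ for $\Gamma=\mathbb Z_6$, and $HP^{odd}(\mathcal A_\theta^{alg}\rtimes\Gamma)\cong 0$ for $\Gamma=\mathbb Z_3,\mathbb Z_4,\mathbb Z_6$.
   Context: Let $\lambda=e^{2\pi i\theta}$ and for $s\in\mathbb R$ write $\lambda^s:=e^{2\pi i\theta s}$. The algebraic noncommutative torus $\mathcal A_\theta^{alg}$ is the complex algebra of finite sums $\sum_{(n,m)\in\mathbb Z^2}a_{n,m}U_1^nU_2^m$, where $U_1,U_2$ are invertible generators with $U_2U_1=\lambda U_1U_2$. An element $g=\begin{pmatrix}g_{11}&g_{12}\\ g_{21}&g_{22}\end{pmatrix}\in SL(2,\mathbb Z)$ acts by the automorphism determined by $g\cdot U_1=e^{\pi i g_{11}g_{21}\theta}U_1^{g_{11}}U_2^{g_{21}}$, $g\cdot U_2=e^{\pi i g_{12}g_{22}\theta}U_1^{g_{12}}U_2^{g_{22}}$. The subgroup $\mathbb Z_3$ is generated by $\omega=\begin{pmatrix}0&1\\-1&-1\end{pmatrix}$ (so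 $U_1\mapsto U_2^{-1}$, $U_2\mapsto\lambda^{-1/2}U_1U_2^{-1}$); $\mathbb Z_4$ is generated by an element acting by $U_1\mapsto U_2^{-1}$, $U_2\mapsto U_1$; $\mathbb Z_6$ is generated by $-\omega=\begin{pmatrix}0&-1\\1&1\end{pmatrix}$ (so $U_1\mapsto U_2$, $U_2\mapsto\lambda^{-1/2}U_1^{-1}U_2$). The crossed product $\mathcal A_\theta^{alg}\rtimes\Gamma$ is $\mathcal A_\theta^{alg}\otimes\mathbb C\Gamma$ with product $(a\otimes g)(b\otimes h)=a(g\cdot b)\otimes gh$. $HP^{even}$, $HP^{odd}$ denote Connes' periodic cyclic cohomology (the direct limits of $HC^{2n}$, resp. $HC^{2n+1}$, under the periodicity operator $S$). *)

(* Defs.v *)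
From mathcomp Require Import all_boot all_order all_algebra.
From mathcomp Require Import complex.
From mathcomp Require Import all_classical all_reals all_analysis.
Set Implicit Arguments. Unset Strict Implicit. Unset Printing Implicit Defensive.
Import Order.TTheory GRing.Theory Num.Theory.
Local Open Scope ring_scope.

(* Part 1. Periodic cyclic cohomology of a unital complex algebra given by   *)
(* a basis [Bs] with unit [e] and multiplication table [mul]:                *)
(*     x * y = (mul x y).1 * (mul x y).2   (x, y, (mul x y).2 basis elements)*)
(* A multilinear functional A^(n+1) -> C is the same as an arbitrary         *)
(* function on (n+1)-tuples of basis elements; we represent an n-cochain by  *)
(* a function [seq Bs -> C], only its values on lists of size n+1 matter.    *)
Section CyclicCohomology.
Variable C : fieldType.
Variable Bs : Type.
Variable e : Bs.
Variable mul : Bs -> Bs -> C * Bs.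

Definition cochain := seq Bs -> C.

Definition contract (x : seq Bs) (i : nat) : C * seq Bs :=
  let cy := mul (nth e x i) (nth e x i.+1) in
  (cy.1, take i x ++ cy.2 :: drop i.+2 x).

Definition hoch_b (phi : cochain) (n : nat) : cochain := fun x =>
  \sum_(i < n.+1) (-1) ^+ i * ((contract x i).1 * phi (contract x i).2)
  + (-1) ^+ n.+1 *
    ((mul (nth e x n.+1) (nth e x 0)).1 *
      phi ((mul (nth e x n.+1) (nth e x 0)).2 :: take n (behead x))).

Definition conB0 (phi : cochain) (n : nat) : cochain := fun x =>
  phi (e :: x) - (-1) ^+ n.+1 * phi (rcons x e).

Definition conB (phi : cochain) (n : nat) : cochain := fun x =>
  \sum_(j < n.+1) (-1) ^+ (n * j) * conB0 phi n (rot j x).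

(* A cochain of total degree n of the (b,B) bicomplex: a family of
   Hochschild cochains; only the components k <= n, k = n mod 2 matter. *)
Definition family := nat -> cochain.

Definition HC_cocycle (n : nat) (phi : family) : Prop :=
  forall (j : nat) (x : seq Bs), (j <= n.+1)%N -> odd j = ~~ odd n ->
    size x = j.+1 ->
    (if j is j'.+1 then hoch_b (phi j') j' x else 0)
    + (if (j.+1 <= n)%N then conB (phi j.+1) j x else 0) = 0.

Definition HC_coboundary (n : nat) (phi : family) : Prop :=
  exists psi : family,
  forall (k : nat) (x : seq Bs), (k <= n)%N -> odd k = odd n ->
    size x = k.+1 ->
    phi k x = (if k is k'.+1 then hoch_b (psi k') k' x else 0)
              + (if (k.+2 <= n)%N then conB (psi k.+1) k x else 0).

(* Periodicity operator S : HC^n -> HC^(n+2) is the inclusion of the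
   truncated bicomplex (phi_n, phi_(n-2), ...) |-> (0, phi_n, phi_(n-2), ...);
   its iterates S^r from degree n are all given by [trunc n]. *)
Definition trunc (n : nat) (phi : family) : family :=
  fun k => if (k <= n)%N then phi k else (fun _ => 0).

Definition fam_sub (phi psi : family) : family := fun k x => phi k x - psi k x.

Definition lincomb (d : nat) (a : 'I_d -> C) (c : 'I_d -> family) : family :=
  fun k x => \sum_(i < d) a i * c i k x.

(* HP^p (p = 0 : even, p = 1 : odd) = direct limit over m of HC^(p+2m) under S.
   [HP_isom_Cd p d] : this direct limit is isomorphic to C^d, i.e. it has a
   basis of d elements: classes [c_0],...,[c_(d-1)] (represented in a common
   degree p+2 m0) that are linearly independent in the direct limit (no
   nontrivial combination becomes a coboundary after applying S^r) and span
   it (every cocycle becomes, after applying some S^r, cohomologous to a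
   combination of the S-images of the c_i). *)
Definition HP_isom_Cd (p d : nat) : Prop :=
  exists (m0 : nat) (c : 'I_d -> family),
    (forall i, HC_cocycle (p + 2 * m0) (c i)) /\
    (forall (m : nat) (a : 'I_d -> C), (m0 <= m)%N ->
       HC_coboundary (p + 2 * m) (trunc (p + 2 * m0) (lincomb a c)) ->
       forall i, a i = 0) /\
    (forall (m : nat) (phi : family), HC_cocycle (p + 2 * m) phi ->
       exists (m' : nat) (a : 'I_d -> C), [/\ (m <= m')%N, (m0 <= m')%N &
         HC_coboundary (p + 2 * m')
           (fam_sub (trunc (p + 2 * m) phi) (trunc (p + 2 * m0) (lincomb a c)))]).

End CyclicCohomology.

Section CrossedProduct.
Variable R : realType.
Variable theta : R.
Local Notation C := (R[i]).

Definition lam (s : R) : C :=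
  Complex (cos (2 * pi * theta * s)) (sin (2 * pi * theta * s)).

(* Monomials c U1^a U2^b of A_theta^alg, encoded as (c, a, b).  The algebra
   A_theta^alg has the basis U1^a U2^b (a, b in Z), and since
   U2^b U1^a' = lambda^(b a') U1^a' U2^b (from U2 U1 = lambda U1 U2):
     (c U1^a U2^b)(c' U1^a' U2^b') = c c' lambda^(b a') U1^(a+a') U2^(b+b'). *)
Definition mono := (C * int * int)%type.
Definition mmul (m m' : mono) : mono :=
  let '(c, a, b) := m in let '(c', a', b') := m' in
  (c * c' * lam (b * a')%:~R, a + a', b + b').
Definition mone : mono := (1, 0, 0).
Definition minv (m : mono) : mono :=
  let '(c, a, b) := m in (c^-1 * lam (a * b)%:~R, - a, - b).
Definition mpow (m : mono) (z : int) : mono :=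
  match z with
  | Posz n => iter n (mmul m) mone
  | Negz n => iter n.+1 (mmul (minv m)) mone
  end.

Definition mat := (int * int * int * int)%type.
Definition matmul (g h : mat) : mat :=
  let '(g11, g12, g21, g22) := g in let '(h11, h12, h21, h22) := h in
  (g11 * h11 + g12 * h21, g11 * h12 + g12 * h22,
   g21 * h11 + g22 * h21, g21 * h12 + g22 * h22).
Definition mat1 : mat := (1, 0, 0, 1).
Definition matpow (g : mat) (j : nat) : mat := iter j (matmul g) mat1.

(* action of g in SL(2,Z):  g.U1 = e^(pi i g11 g21 theta) U1^g11 U2^g21,
   g.U2 = e^(pi i g12 g22 theta) U1^g12 U2^g22, extended as an automorphism:
   g.(U1^c U2^d) = (g.U1)^c (g.U2)^d. *)
Definition gU1 (g : mat) : mono :=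
  let '(g11, g12, g21, g22) := g in (lam ((g11 * g21)%:~R / 2), g11, g21).
Definition gU2 (g : mat) : mono :=
  let '(g11, g12, g21, g22) := g in (lam ((g12 * g22)%:~R / 2), g12, g22).
Definition act (g : mat) (c d : int) : mono :=
  mmul (mpow (gU1 g) c) (mpow (gU2 g) d).

Inductive cycsub := Z3 | Z4 | Z6.
(* generator: omega for Z3, U1 |-> U2^-1, U2 |-> U1 for Z4, -omega for Z6 *)
Definition gen (G : cycsub) : mat :=
  match G with
  | Z3 => (0, 1, -1, -1)
  | Z4 => (0, 1, -1, 0)
  | Z6 => (0, -1, 1, 1)
  end.
Definition ordm1 (G : cycsub) : nat :=
  match G with Z3 => 2 | Z4 => 3 | Z6 => 5 end.

(* basis of A_theta^alg |x Gamma : U1^a U2^b (x) gen^j,  j < |Gamma| *)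
Definition cpbasis (G : cycsub) := (int * int * 'I_(ordm1 G).+1)%type.
Definition cpunit (G : cycsub) : cpbasis G := (0, 0, 0).

Definition cpmul (G : cycsub) (x y : cpbasis G) : C * cpbasis G :=
  let '(a, b, j) := x in let '(c, d, l) := y in
  let '(s, p, q) := mmul (1, a, b) (act (matpow (gen G) j) c d) in
  (s, (p, q, j + l)).

End CrossedProduct.

(* Main.v *)
(** The basis of the crossed product is, up to phases, the crystallographic group
    G = Z^2 x| Gamma, so the algebra is a twisted group algebra C_chi[G] with central
    extension X.  Its Hochschild cochains are the G-invariant functions
    F(g_0, ..., g_n; y) on G^(n+1) x X that are chi-homogeneous in y, and b becomes
    the simplicial coboundary in the g_i.  Averaging over Gamma leaves Z^2-invariance,
    which can be imposed one generator t at a time because F |-> tF - F is surjective;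
    this gives HH^n = 0 for n >= 3.  In degrees 1 and 2 one splits according to y.
    If y has a nontrivial rotation part, y determines a lattice point equivariantly and
    coning off to it is an equivariant contraction.  If y is a nonzero translation,
    irrationality makes some t act on it by a phase <> 1.  If y is central one is left
    with H^n(G, C), which is 0 for n = 1 and spanned by the signed area for n = 2.
    Hence HH^odd = 0, HH^2 = C, and by the (b,B) bicomplex HP^odd = 0 while HP^even is
    spanned by the area cocycle and the traces.  The traces are the functions on the
    conjugacy classes of elements with nontrivial rotation part, together with the
    canonical trace: 7, 8, 9 dimensions for Z_3, Z_4, Z_6. *)

From HB Require Import structures.
From mathcomp Require Import all_boot all_order all_algebra.
From mathcomp Require Import complex.
From mathcomp Require Import all_classical all_reals all_analysis.
From mathcomp Require Import ring lra zify.
Require Import Defs.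
Set Implicit Arguments. Unset Strict Implicit. Unset Printing Implicit Defensive.
Import Order.TTheory GRing.Theory Num.Theory.
Local Open Scope ring_scope.

(** * The (b,B) bicomplex of a unital based algebra *)

(** Cochains are arbitrary functions on the basis, with no growth condition. Sums along lattice
    orbits and divisions by lambda^k - 1 therefore need no estimate, and irrationality is the only
    arithmetic input. X replaces a scalar 2-cocycle on G: it records powers of lambda^(1/2), the
    half being forced by the Weyl ordering lambda^(ab/2) U1^a U2^b, in which rotations act without
    phases. The obstacle is that coning off the simplex to a vertex destroys invariance, and each
    lattice direction restored costs one degree. In degrees 1 and 2 the remaining obstruction is a
    function of y alone; it is divided away by a phase minus 1 wherever some translation acts on y
    by a nontrivial phase. The number of traces is one plus, for each nontrivial rotation g, the
    number of Gamma-orbits on Z^2 / (1 - g) Z^2: 1 + 3 + 3, 1 + 2 + 3 + 2 and 1 + 1 + 2 + 2 + 2 +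
    1. *)

Section MixedComplex.
Variables (C : fieldType) (Bs : Type) (e : Bs) (mul : Bs -> Bs -> C * Bs).
Hypothesis mul_el : forall x, mul e x = (1, x).
Hypothesis mul_er : forall x, mul x e = (1, x).
Implicit Types (phi psi : cochain C Bs) (x l : seq Bs) (n m i j k : nat).

Local Notation b := (hoch_b e mul).
Local Notation B0 := (conB0 e).
Local Notation B := (conB e).

Definition b_prime phi n : cochain C Bs := fun x =>
  \sum_(i < n.+1) (-1) ^+ i * ((contract e mul x i).1 * phi (contract e mul x i).2).

(** [conB] is by definition this norm operator N applied to [conB0], so identities about B reduce to
    identities about N. *)
Definition cyc_norm phi n : cochain C Bs := fun x =>
  \sum_(j < n.+1) (-1) ^+ (n * j) * phi (rot j x).

Definition face0 phi : cochain C Bs := fun x =>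
  (mul (nth e x 0) (nth e x 1)).1 *
  phi ((mul (nth e x 0) (nth e x 1)).2 :: drop 2 x).

(** Every face, the wrap-around one included, is face 0 conjugated by rotations; this turns the
    cyclic identities below into reindexings of sums. *)
Definition face phi i : cochain C Bs := fun x => face0 (phi \o rotr i) (rot i x).

Lemma contract_face phi n x i : size x = n.+2 -> (i <= n)%N ->
  (contract e mul x i).1 * phi (contract e mul x i).2 = face phi i x.
Proof.
move=> sx lin; rewrite /face /face0 /contract /=.
have h2 : (i.+2 <= size x)%N by rewrite sx.
have h1 := ltnW h2; have h0 := ltnW h1.
rewrite /rot; set s := take i x.
have ss : size s = i by rewrite size_take_min (minn_idPl h0).
rewrite (drop_nth e h1) /= (drop_nth e h2) /=.
congr (_ * phi _).
by rewrite -[X in rotr X]ss /= drop0 -cat_cons rotr_size_cat.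
Qed.

Lemma last_face phi n x : size x = n.+2 ->
  (mul (nth e x n.+1) (nth e x 0)).1 *
      phi ((mul (nth e x n.+1) (nth e x 0)).2 :: take n (behead x))
  = face phi n.+1 x.
Proof.
case: x => // x0 x [sx]; rewrite /face /face0 /=.
case/lastP: x sx => // x xn; rewrite size_rcons => -[sx].
have -> : rot n.+1 (x0 :: rcons x xn) = [:: xn, x0 & x].
  by rewrite -sx -cats1 -cat_cons (rot_size_cat (x0 :: x)).
rewrite /= nth_rcons sx ltnn eqxx -cats1 take_size_cat // drop0.
by rewrite /rotr /= sx subnn rot0.
Qed.

Lemma hoch_b_face phi n x : size x = n.+2 ->
  b phi n x = \sum_(i < n.+2) (-1) ^+ i * face phi i x.
Proof.
move=> sx; rewrite /hoch_b [RHS]big_ord_recr /= (last_face phi sx); congr (_ + _).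
by apply: eq_bigr => i _; rewrite (contract_face phi sx) // -ltnS.
Qed.

Lemma b_prime_face phi n x : size x = n.+2 ->
  b_prime phi n x = \sum_(i < n.+1) (-1) ^+ i * face phi i x.
Proof.
move=> sx; apply: eq_bigr => i _.
by rewrite (contract_face phi sx) // -ltnS.
Qed.

Lemma eq_conB phi psi n x : size x = n.+1 ->
  (forall l, size l = n.+2 -> phi l = psi l) -> B phi n x = B psi n x.
Proof.
move=> sx eqf; apply: eq_bigr => i _.
by rewrite /conB0 !eqf //= ?size_rcons size_rot sx.
Qed.

Lemma hoch_bD phi psi n x :
  b (fun l => phi l + psi l) n x = b phi n x + b psi n x.
Proof.
rewrite /hoch_b addrACA -big_split /= !mulrDr; congr (_ + _).
by apply: eq_bigr => i _; rewrite !mulrDr.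
Qed.

Lemma hoch_bZ a phi n x : b (fun l => a * phi l) n x = a * b phi n x.
Proof.
rewrite /hoch_b mulrDr mulr_sumr; congr (_ + _); last by ring.
by apply: eq_bigr => i _; ring.
Qed.

Lemma hoch_bB phi psi n x :
  b (fun l => phi l - psi l) n x = b phi n x - b psi n x.
Proof.
rewrite -[- b psi n x]mulN1r -hoch_bZ -hoch_bD.
by congr (b _ n x); apply: boolp.funext => l; rewrite mulN1r.
Qed.

Lemma conBD phi psi n x :
  B (fun l => phi l + psi l) n x = B phi n x + B psi n x.
Proof.
rewrite /conB -big_split /=; apply: eq_bigr => i _; rewrite /conB0; ring.
Qed.

Lemma conBZ a phi n x : B (fun l => a * phi l) n x = a * B phi n x.
Proof.
rewrite /conB mulr_sumr; apply: eq_bigr => i _; rewrite /conB0; ring.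
Qed.

Lemma conBB phi psi n x :
  B (fun l => phi l - psi l) n x = B phi n x - B psi n x.
Proof.
rewrite -[- B psi n x]mulN1r -conBZ -conBD.
by congr (B _ n x); apply: boolp.funext => l; rewrite mulN1r.
Qed.

Lemma hoch_b0 n x : b (fun=> 0) n x = 0.
Proof. by rewrite /hoch_b big1 ?add0r ?mulr0 // => i _; rewrite !mulr0. Qed.

Lemma conB_0 n x : B (fun=> 0 : C) n x = 0.
Proof. by rewrite /conB big1 // => i _; rewrite /conB0 !mulr0 subr0 mulr0. Qed.

Lemma hoch_b_sum (I : Type) (r : seq I) (F : I -> cochain C Bs) n x :
  b (fun l => \sum_(i <- r) F i l) n x = \sum_(i <- r) b (F i) n x.
Proof.
elim: r => [|i r IHr].
  rewrite big_nil -[RHS](hoch_b0 n x); congr (b _ n x).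
  by apply: boolp.funext => l; rewrite big_nil.
rewrite big_cons -IHr -hoch_bD; congr (b _ n x).
by apply: boolp.funext => l; rewrite big_cons.
Qed.

Lemma cyc_norm_rot1 phi n x : size x = n.+1 ->
  cyc_norm phi n (rot 1 x) = (-1) ^+ n * cyc_norm phi n x.
Proof.
move=> sx; rewrite /cyc_norm big_ord_recr big_ord_recl /= mulrDr addrC mulr_sumr.
have rotD j : (j < size x)%N -> rot j (rot 1 x) = rot j.+1 x.
  by move=> lj; rewrite rot_rot -rotS.
congr (_ + _).
  by rewrite muln0 expr0 mul1r rot0 rotD ?sx // -sx rot_size -signr_odd oddM andbb signr_odd.
apply: eq_bigr => i _.
rewrite rotD ?sx ?ltnS 1?ltnW // mulrA -exprD; congr (_ * _).
by rewrite /bump /= add1n mulnS addnA -[RHS]signr_odd !oddD addbb addFb signr_odd.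
Qed.

Lemma cyc_norm_rot phi n x i : size x = n.+1 -> (i <= n.+1)%N ->
  cyc_norm phi n (rot i x) = (-1) ^+ (n * i) * cyc_norm phi n x.
Proof.
move=> sx; elim: i => [|i IHi] li; first by rewrite rot0 muln0 mul1r.
rewrite rotS ?sx // cyc_norm_rot1 ?size_rot // IHi 1?ltnW //.
by rewrite mulrA -exprD mulnS.
Qed.

Lemma cyc_norm_rotr phi n x i : size x = n.+1 -> (i <= n.+1)%N ->
  cyc_norm phi n (rotr i x) = (-1) ^+ (n * i) * cyc_norm phi n x.
Proof.
move=> sx li; rewrite -{2}(rotrK i x) cyc_norm_rot ?size_rotr // mulrA -exprD.
by rewrite addnn -signr_odd odd_double mul1r.
Qed.

Lemma cyc_norm_compr phi n x i : size x = n.+1 -> (i <= n.+1)%N ->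
  cyc_norm (phi \o rot i) n x = (-1) ^+ (n * i) * cyc_norm phi n x.
Proof.
move=> sx li; rewrite -cyc_norm_rot //; apply: eq_bigr => j _ /=.
by rewrite rot_rot.
Qed.

Lemma cyc_norm_rev phi n x : size x = n.+1 ->
  \sum_(i < n.+1) (-1) ^+ (n * i) * phi (rotr i x) = cyc_norm phi n x.
Proof.
move=> sx; rewrite /cyc_norm !big_ord_recl /= /rotr subn0 rot_size rot0; congr (_ + _).
rewrite [RHS](reindex_inj rev_ord_inj) /=; apply: eq_bigr => i _.
rewrite /bump /= !add1n sx; have li := ltn_ord i.
have -> : (n.+1 - i.+1 = (n - i.+1).+1)%N by lia.
congr (_ * _); rewrite -[LHS]signr_odd -[RHS]signr_odd; congr (_ ^+ nat_of_bool _).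
by rewrite !oddM !oddS oddB // oddS; case: (odd n); case: (odd i).
Qed.

(** The identity b N = N b'. Pulling rotations through N costs only signs, and both sides become the
    same double sum of [face0] terms, over a rotation of x and a rotation of the arguments of
    phi. *)
Lemma hoch_b_cyc_norm phi n x : size x = n.+2 ->
  b (cyc_norm phi n) n x = cyc_norm (b_prime phi n) n.+1 x.
Proof.
move=> sx; have szd j k : size (drop 2 (rot j (rot k x))) = n.
  by rewrite size_drop !size_rot sx subn2.
transitivity (\sum_(k < n.+2) (-1) ^+ (n.+1 * k) *
                face0 (cyc_norm phi n) (rot k x)).
  rewrite hoch_b_face //; apply: eq_bigr => k _.
  rewrite /face /face0 /= cyc_norm_rotr //; last 2 first.
  - by rewrite /= -(rot0 x) szd.
  - by rewrite -ltnS.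
  by rewrite mulSn exprD; ring.
transitivity (\sum_(i < n.+1) (-1) ^+ i * cyc_norm (face phi i) n.+1 x); last first.
  under eq_bigr do rewrite /cyc_norm mulr_sumr.
  rewrite exchange_big /=; apply: eq_bigr => k _.
  rewrite b_prime_face ?size_rot // mulr_sumr; apply: eq_bigr => i _; ring.
under [RHS]eq_bigr => i _.
  rewrite [cyc_norm _ _ _](cyc_norm_compr (face0 (phi \o rotr i))) //; last first.
    by have := ltn_ord i; lia.
  rewrite mulrA -exprD -mulSn /cyc_norm mulr_sumr.
  over.
rewrite exchange_big /=; apply: eq_bigr => k _.
rewrite /face0 -(@cyc_norm_rev _ n) /=; last by rewrite -(rot0 x) szd.
rewrite !mulr_sumr; apply: eq_bigr => i _ /=.
have -> : (-1) ^+ (n.+2 * i) = (-1) ^+ (n * i) :> C.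
  by rewrite -signr_odd oddM /= negbK -oddM signr_odd.
ring.
Qed.

Lemma contract_cons y x i :
  contract e mul (y :: x) i.+1 = ((contract e mul x i).1, y :: (contract e mul x i).2).
Proof. by []. Qed.

Lemma contract_rcons y x i : (i.+1 < size x)%N ->
  contract e mul (rcons x y) i
  = ((contract e mul x i).1, rcons (contract e mul x i).2 y).
Proof.
move=> li; rewrite /contract !nth_rcons li (ltnW li) /=; congr (_, _).
rewrite -!cats1 -catA /= take_cat (ltnW li) drop_cat.
case: ltnP => // ge; have -> : i.+2 = size x by apply/eqP; rewrite eqn_leq ge li.
by rewrite subnn drop_size.
Qed.

(** A unit inserted in front or at the end is absorbed by its neighbour, which leaves 1 - t for the
    signed rotation t. Since N kills 1 - t, this gives Bb + bB = 0. *)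
Lemma conB0_hoch_b psi n x : size x = n.+2 ->
  B0 (b psi n.+1) n.+1 x + b_prime (B0 psi n) n x
  = psi x - (-1) ^+ n.+1 * psi (rotr 1 x).
Proof.
move=> sx.
have bl : b psi n.+1 (e :: x) =
    psi x - b_prime (fun l => psi (e :: l)) n x + (-1) ^+ n.+2 * psi (rotr 1 x).
  rewrite /hoch_b /b_prime big_ord_recl; congr (_ + _ + _).
  - rewrite expr0 mul1r /contract /= mul_el /=.
    by case: x sx => //= x0 x _; rewrite mul1r drop0.
  - rewrite -sumrN; apply: eq_bigr => i _; rewrite lift0 contract_cons /= exprS.
    by rewrite mulN1r mulNr.
  - congr (_ * _); rewrite /= mul_er /= mul1r.
    case/lastP: x sx => // x xn; rewrite size_rcons => -[sx].
    by rewrite rotr1_rcons nth_rcons sx ltnn eqxx -cats1 take_size_cat.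
have br : b psi n.+1 (rcons x e) = b_prime (fun l => psi (rcons l e)) n x.
  rewrite /hoch_b /b_prime big_ord_recr -addrA -[RHS]addr0; congr (_ + _).
    apply: eq_bigr => i _; have li : (i.+1 < size x)%N by rewrite sx ltnS ltn_ord.
    by rewrite contract_rcons.
  rewrite nth_rcons sx ltnn eqxx.
  have -> : nth e (rcons x e) 0 = nth e x 0 by case: (x) sx.
  rewrite mul_el mul1r.
  have -> : (contract e mul (rcons x e) n.+1) = (1, x).
    rewrite /contract !nth_rcons sx ltnSn ltnn eqxx mul_er /= -cats1 drop_oversize.
      rewrite take_cat sx ltnSn -{3}(cat_take_drop n.+1 x) (drop_nth e) ?sx //.
      by rewrite drop_oversize ?sx.
    by rewrite size_cat sx addn1.
  have -> : (1 : C, nth e x 0).2 :: take n.+1 (behead (rcons x e)) = x.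
    by case: (x) sx => //= x0 x1 [sx]; rewrite -cats1 take_size_cat.
  by rewrite /= !mul1r [in X in _ + X]exprS mulN1r mulNr subrr.
rewrite /conB0 bl br {bl br}.
have -> : b_prime (fun x => psi (e :: x) - (-1) ^+ n.+1 * psi (rcons x e)) n x
   = b_prime (fun l => psi (e :: l)) n x - (-1) ^+ n.+1 * b_prime (fun l => psi (rcons l e)) n x.
  rewrite /b_prime mulr_sumr -sumrB; apply: eq_bigr => i _; ring.
rewrite [in (-1) ^+ n.+2]exprS; ring.
Qed.

Lemma hoch_b_conB psi n x : size x = n.+2 ->
  B (b psi n.+1) n.+1 x + b (B psi n) n x = 0.
Proof.
move=> sx; rewrite [b _ _ _]hoch_b_cyc_norm // /conB /cyc_norm -big_split /=.
under eq_bigr => i _.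
  rewrite -mulrDr conB0_hoch_b ?size_rot // mulrBr.
  over.
rewrite big_split /= sumrN -/(cyc_norm psi n.+1 x).
have -> : cyc_norm psi n.+1 x = (-1) ^+ n.+1 * cyc_norm (psi \o rotr 1) n.+1 x.
  have := @cyc_norm_compr (psi \o rotr 1) n.+1 x 1 sx isT; rewrite muln1 => <-.
  by apply: eq_bigr => i _ /=; rewrite rotK.
rewrite /cyc_norm mulr_sumr -sumrB big1 // => i _ /=; ring.
Qed.

(** Already B0 B = 0: cochains in the image of B are cyclic, and the two lists formed by [conB0]
    differ by a rotation. *)
Lemma conB_conB phi n x : size x = n.+1 -> B (B phi n.+1) n x = 0.
Proof.
move=> sx; rewrite [LHS]big1 // => i _; rewrite /conB0.
have -> l : rcons l e = rot 1 (e :: l) by rewrite rot1_cons.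
rewrite [B _ _ (rot 1 _)]cyc_norm_rot1 /= ?size_rot ?sx // mulrA.
by rewrite -expr2 sqrr_sign mul1r subrr mulr0.
Qed.

(** The bottom case of Bb + bB = 0, where the term bB is absent. *)
Lemma conB_hoch_b_deg0 psi x : size x = 1%N -> B (b psi 0) 0 x = 0.
Proof.
case: x => [|x0 []] // _; rewrite /conB big_ord1 /conB0 /hoch_b !big_ord1 /=.
by rewrite /contract /= !mul_el !mul_er /=; ring.
Qed.

(* Since all odd Hochschild cohomology vanishes and even cohomology vanishes above
   degree 2, the periodicity operator is bijective from degree 2 on. *)
Section PeriodicReduction.
Variables (c : cochain C Bs) (d : nat) (tau : 'I_d -> cochain C Bs) (rep : 'I_d -> Bs).
Hypothesis hoch_vanish : forall n phi, n.+1 != 2%N ->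
  (forall x, size x = n.+3 -> b phi n.+1 x = 0) ->
  exists psi, forall x, size x = n.+2 -> phi x = b psi n x.
Hypothesis hoch_deg2 : forall phi, (forall x, size x = 4%N -> b phi 2 x = 0) ->
  exists a psi, forall x, size x = 3%N -> phi x = a * c x + b psi 1 x.
Hypothesis c_cocycle : forall x, size x = 4%N -> b c 2 x = 0.
Hypothesis c_conB : forall x, size x = 2%N -> B c 1 x = 0.
Hypothesis c_nontrivial : forall a psi,
  (forall x, size x = 3%N -> a * c x = b psi 1 x) -> a = 0.
Hypothesis tau_trace : forall (i : 'I_d) x, size x = 2%N -> b (tau i) 0 x = 0.
Hypothesis tau_rep : forall i : 'I_d, tau i [:: rep i] != 0.
Hypothesis tau_rep_off : forall i j : 'I_d, i != j -> tau i [:: rep j] = 0.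
Hypothesis trace_rep : forall phi, (forall x, size x = 2%N -> b phi 0 x = 0) ->
  (forall i : 'I_d, phi [:: rep i] = 0) -> forall x, size x = 1%N -> phi x = 0.

(** Degree n + 3 is never the exceptional degree 2, so the top component has a primitive psi.
    Subtracting (b + B) psi removes that component, changes only the next one, and leaves the
    S-image of a cocycle two degrees lower. *)
Lemma HC_descend n (phi : Defs.family C Bs) : HC_cocycle e mul n.+3 phi ->
  exists psi (phi' : Defs.family C Bs),
  [/\ HC_cocycle e mul n.+1 phi',
      forall x, size x = n.+4 -> phi n.+3 x = b psi n.+2 x,
      forall x, size x = n.+2 -> phi n.+1 x = phi' n.+1 x + B psi n.+1 x &
      forall k, (k <= n)%N -> phi' k = phi k].
Proof.
move=> coc.
have [psi psiP] : exists psi, forall x, size x = n.+4 -> phi n.+3 x = b psi n.+2 x.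
  apply: hoch_vanish => // x sx; have := coc n.+4 x (leqnn _) _ sx.
  by rewrite ltnNge leqnSn addr0; apply; rewrite /= !negbK.
exists psi, (fun k => if k == n.+1 then fun x => phi k x - B psi k x else phi k).
split=> // [j x lej par sx | x sx | k lek]; last 2 first.
- by rewrite eqxx subrK.
- by rewrite ltn_eqF.
move: lej; rewrite leq_eqVlt => /predU1P[ej|lej].
  rewrite {}ej in par sx *; rewrite eqxx ltnNge leqnSn /= addr0 hoch_bB.
  have le2 : (n.+2 <= n.+4)%N by rewrite 2?leqW.
  have par2 : odd n.+2 = ~~ odd n.+3 by rewrite /= !negbK.
  have := coc n.+2 x le2 par2 sx; rewrite leqnn /= => /eqP.
  rewrite addr_eq0 => /eqP ->.
  rewrite (@eq_conB _ (b psi n.+2)) //; apply/eqP.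
  by rewrite -opprD oppr_eq0 hoch_b_conB.
have {}lej : (j <= n)%N.
  rewrite leqNgt; apply/negP => ltnj; move: par.
  have -> : j = n.+1 by apply/eqP; rewrite eqn_leq ltnj -ltnS lej.
  by case: odd.
have lej3 : (j < n.+3)%N by rewrite ltnS 2?leqW.
have par3 : odd j = ~~ odd n.+3 by rewrite par /= !negbK.
have := coc j x (ltnW (leqW lej3)) par3 sx; rewrite lej3 ltnS lej eqSS => H.
rewrite -[RHS]H {H}.
congr (_ + _).
  by case: (j) lej => // j1 /leqW lej1; rewrite ltn_eqF.
case: eqP => // ej; subst j.
by rewrite conBB conB_conB // subr0.
Qed.

(** L stands for the low-degree family that phi will be compared with; quantifying over it lets the
    induction carry the relation before L is chosen. *)
Lemma HC_reduce n m (phi : Defs.family C Bs) : HC_cocycle e mul (n.+1 + 2 * m) phi ->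
  exists2 phi' : Defs.family C Bs, HC_cocycle e mul n.+1 phi' &
  forall L : Defs.family C Bs, (forall k x, (n.+1 < k)%N -> L k x = 0) ->
  HC_coboundary e mul n.+1 (fam_sub phi' L) ->
  HC_coboundary e mul (n.+1 + 2 * m) (fam_sub phi L).
Proof.
elim: m phi => [|m IHm] phi; first by rewrite muln0 addn0 => coc; exists phi.
have -> : (n.+1 + 2 * m.+1 = (n + 2 * m).+3)%N by lia.
move=> /HC_descend[psi [phi1 [/IHm[phi' coc' cob'] top sub low]]].
exists phi' => // L L0 /(cob' L L0); rewrite addSn => -[psi' psi'P].
exists (fun k => if k == (n + 2 * m).+2 then psi else psi' k) => k x lek par sx.
rewrite /fam_sub; move: lek; rewrite leq_eqVlt => /predU1P[ek|lek].
  rewrite {}ek in par sx *.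
  by rewrite eqxx ltnNge leqnSn addr0 L0 ?subr0 ?top //; lia.
have {lek} lek : (k <= (n + 2 * m).+1)%N.
  rewrite -ltnS ltn_neqAle -ltnS lek andbT; apply/eqP => ek; move: par.
  by rewrite ek /=; case: odd.
have := psi'P k x lek; rewrite {1}/fam_sub => /(_ _ sx) H.
move: lek; rewrite leq_eqVlt => /predU1P[ek|lek].
  subst k; rewrite sub // addrAC H //.
  rewrite ltnNge leqnSn addr0 eqxx ltnSn; congr (_ + _).
  by rewrite ltn_eqF.
have {lek} lek : (k < n + 2 * m)%N.
  rewrite ltn_neqAle -ltnS lek andbT; apply/eqP => ek; move: par.
  by rewrite ek /=; case: odd.
rewrite -(low k (ltnW lek)) H; last by rewrite par /= negbK.
have lek3 : (k.+1 < (n + 2 * m).+3)%N by rewrite ltnS ltnW // ltnW // ltnS ltnW.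
rewrite lek3 [(k.+1 < _.+1)%N]lek (@ltn_eqF k.+1) ?ltnS 1?ltnW //.
congr (_ + _); case: (k) lek => // k1 lek1.
by rewrite ltn_eqF // ltnW // ltnW // ltnW.
Qed.

Lemma HP_odd : HP_isom_Cd e mul 1 0.
Proof.
exists 0%N, (fun=> fun _ _ => 0); split; first by case.
split=> [? ? _ _ []//|m phi coc].
exists m, (fun=> 0); split=> //.
have {coc}[phi' coc' cob] := HC_reduce coc.
have [||psi psiP] := cob (fun _ _ => 0) => //.
  have [psi psiP] : exists psi, forall x, size x = 2%N -> phi' 1%N x = b psi 0 x.
    by apply: hoch_vanish => // x sx; have := coc' 2%N x isT erefl sx; rewrite addr0.
  exists (fun=> psi) => -[|[|k]] x // _ _ sx.
  by rewrite /fam_sub subr0 addr0 psiP.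
exists psi => k x lek par sx; rewrite -psiP // /fam_sub subr0 /trunc lek.
by case: ifP => _; rewrite ?subr0 // /lincomb big_ord0 subr0.
Qed.

(** Injectivity of S on even degrees. The top equation makes psi_(n+2) a Hochschild cocycle of odd
    degree, hence b chi, and subtracting (b + B) chi from psi shortens it. *)
Lemma HC_coboundary_drop n (L : Defs.family C Bs) :
  (forall k x, (n.+1 < k)%N -> L k x = 0) ->
  odd n -> HC_coboundary e mul n.+3 L -> HC_coboundary e mul n.+1 L.
Proof.
move=> L0 oddn [psi psiP].
have [chi chiP] : exists chi, forall x, size x = n.+3 -> psi n.+2 x = b chi n.+1 x.
  apply: hoch_vanish => [|x sx]; first by case: (n) oddn.
  have := psiP n.+3 x (leqnn _) erefl sx.
  by rewrite L0 ?ltnS ?leqnSn // ltnNge leqnSn addr0 => <-.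
exists (fun k => if k == n then fun x => psi n x - B chi n x else psi k) => k x lek par sx.
have lek3 : (k <= n.+3)%N by rewrite 2?leqW.
rewrite (psiP k) //; last by rewrite par /= negbK.
move: lek; rewrite leq_eqVlt => /predU1P[ek|].
  subst k; rewrite eqxx ltnSn ltnNge leqnSn addr0 hoch_bB; congr (_ + _).
  rewrite (@eq_conB _ (b chi n.+1)) //; apply/eqP.
  by rewrite -addr_eq0 hoch_b_conB.
rewrite ltnS leq_eqVlt => /predU1P[ek|lek].
  by move: par; rewrite ek /=; case: odd.
have lek3' : (k.+1 < n.+3)%N by lia.
rewrite lek3' ltnS lek; congr (_ + _).
  by case: (k) lek => // k1 lek1; rewrite ltn_eqF // ltnW.
case: eqP => // ek; rewrite -{}ek.
by rewrite conBB conB_conB // subr0.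
Qed.

Lemma HC_coboundary_drop_to2 m (L : Defs.family C Bs) :
  (forall k x, (2 < k)%N -> L k x = 0) ->
  HC_coboundary e mul (2 + 2 * m) L -> HC_coboundary e mul 2 L.
Proof.
move=> L0; elim: m => [|m IHm]; first by rewrite muln0 addn0.
have -> : (2 + 2 * m.+1 = (1 + 2 * m).+3)%N by lia.
move=> /HC_coboundary_drop H.
apply: IHm; apply: H => [k x lk|]; last by rewrite oddD oddM.
by apply: L0; apply: leq_trans lk; rewrite !ltnS leq_addr.
Qed.

Definition HP_even_basis (i : 'I_d.+1) : Defs.family C Bs := fun k =>
  if unlift ord0 i is Some i' then (if k == 0%N then tau i' else fun=> 0)
  else (if k == 2%N then c else fun=> 0).

Lemma HP_even : HP_isom_Cd e mul 0 d.+1.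
Proof.
have lc0 a x : lincomb a HP_even_basis 0 x = \sum_(i < d) a (lift ord0 i) * tau i x.
  rewrite /lincomb big_ord_recl /HP_even_basis unlift_none /= mulr0 add0r.
  by apply: eq_bigr => i _; rewrite liftK.
have lc2 a x : lincomb a HP_even_basis 2 x = a ord0 * c x.
  rewrite /lincomb big_ord_recl /HP_even_basis unlift_none /= big1 ?addr0 // => i _.
  by rewrite liftK mulr0.
exists 1%N, HP_even_basis; split; last split.
- move=> i [|[|[|[|j]]]] x // _ _ sx; rewrite /HP_even_basis.
    case: unliftP => [i' _|_] /=.
      by rewrite tau_trace // conB_0 addr0.
    by rewrite hoch_b0 c_conB // addr0.
  by case: unliftP => [i' _|_] /=; rewrite ?hoch_b0 ?c_cocycle // addr0.
- move=> m a lem cob.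
  (* Linear independence in the limit is tested in degree 2, where S has become injective. *)
  have {cob} : HC_coboundary e mul 2 (trunc 2 (lincomb a HP_even_basis)).
    apply: (@HC_coboundary_drop_to2 m.-1) => [k x lk|].
      by rewrite /trunc leqNgt lk.
    by have -> : (2 + 2 * m.-1 = 0 + 2 * m)%N by lia.
  move=> [psi psiP].
  have a0 : a ord0 = 0.
    apply: (@c_nontrivial _ (psi 1%N)) => x sx.
    by have := psiP 2%N x isT erefl sx; rewrite /trunc /= lc2 addr0.
  (* With the area coefficient gone, psi_1 is a Hochschild cocycle, so psi_1 = b chi. The
     combination of traces equals B b chi = 0. *)
  have [chi chiP] : exists chi, forall x, size x = 2%N -> psi 1%N x = b chi 0 x.
    apply: hoch_vanish => // x sx.
    by have := psiP 2%N x isT erefl sx; rewrite /trunc /= lc2 addr0 a0 mul0r => <-.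
  have tr0 x : size x = 1%N -> \sum_(i < d) a (lift ord0 i) * tau i x = 0.
    move=> sx; rewrite -lc0; have := psiP 0%N x isT erefl sx; rewrite /trunc /= => ->.
    by rewrite add0r (@eq_conB _ (b chi 0)) // conB_hoch_b_deg0.
  move=> i; case: (unliftP ord0 i) => [i' ->|->//].
  have := tr0 [:: rep i'] erefl.
  rewrite (bigD1 i') //= big1 ?addr0 => [/eqP|j nej].
    by rewrite mulf_eq0 (negPf (tau_rep _)) orbF => /eqP.
  by rewrite tau_rep_off ?mulr0.
move=> m phi coc.
(* A cocycle of degree 0 is first pushed into degree 2 by S, since the reduction ends there. *)
have [m' [phi1 [lem coc1 phi1P]]] : exists m' (phi1 : Defs.family C Bs),
   [/\ (m <= m'.+1)%N, HC_cocycle e mul (2 + 2 * m') phi1 & trunc (0 + 2 * m) phi = phi1].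
  case: m coc => [|m] coc; last first.
    exists m, (trunc (0 + 2 * m.+1) phi); split=> // j x lej par sx.
    have e2 : (2 + 2 * m = 0 + 2 * m.+1)%N by lia.
    rewrite e2 in lej par *; rewrite -[RHS](coc j x) //; congr (_ + _).
      by case: (j) lej => // j' lej; rewrite /trunc -ltnS lej.
    by case: ifP => // lj; rewrite /trunc lj.
  exists 0%N, (trunc 0 phi); split=> // -[|[|[|[|j]]]] x // _ _ sx; rewrite /trunc /=.
    by rewrite conB_0 addr0; have := coc 1%N x isT erefl sx; rewrite addr0.
  by rewrite hoch_b0 addr0.
have [phi' coc' cob] := HC_reduce coc1.
have [a [psi phi2P]] : exists a psi, forall x, size x = 3%N -> phi' 2%N x = a * c x + b psi 1 x.
  by apply: hoch_deg2 => x sx; have := coc' 3%N x isT erefl sx; rewrite addr0.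
(* After subtracting B psi the degree 0 component is a trace, because B of the area cocycle
   vanishes. *)
pose phi0 x := phi' 0%N x - B psi 0 x.
have tr0 x : size x = 2%N -> b phi0 0 x = 0.
  move=> sx; have := coc' 1%N x isT erefl sx; rewrite hoch_bB => /eqP.
  rewrite addr_eq0 => /eqP ->; rewrite (@eq_conB _ (fun l => a * c l + b psi 1 l)) //.
  by rewrite conBD conBZ c_conB // mulr0 add0r; apply/eqP; rewrite -opprD oppr_eq0 hoch_b_conB.
pose a' (i : 'I_d.+1) := if unlift ord0 i is Some i' then
   phi0 [:: rep i'] / tau i' [:: rep i'] else a.
have a'0 : a' ord0 = a by rewrite /a' unlift_none.
exists m'.+1, a'; split=> //.
have phi0E x : size x = 1%N -> phi0 x = \sum_(i < d) a' (lift ord0 i) * tau i x.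
  move=> sx; apply/eqP; rewrite -subr_eq0; apply/eqP; move: x sx.
  apply: (trace_rep (phi := fun x => phi0 x - \sum_(i < d) a' (lift ord0 i) * tau i x)).
    move=> x sx; rewrite hoch_bB tr0 // sub0r; apply/eqP; rewrite oppr_eq0; apply/eqP.
    by rewrite hoch_b_sum big1 // => i _; rewrite hoch_bZ tau_trace // mulr0.
  move=> i; rewrite (bigD1 i) //= big1 => [|j nej]; last by rewrite tau_rep_off ?mulr0.
  by rewrite /a' liftK addr0 divfK ?subrr.
have -> : (0 + 2 * m'.+1 = 2 + 2 * m')%N by lia.
rewrite phi1P; apply: cob => [k x lk|]; first by rewrite /trunc leqNgt lk.
exists (fun=> psi) => -[|[|[|k]]] x // _ _ sx; rewrite /fam_sub /trunc /=.
  by rewrite lc0 -phi0E // /phi0 opprB addrC subrK add0r.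
by rewrite lc2 a'0 phi2P // addrC addKr addr0.
Qed.
End PeriodicReduction.
End MixedComplex.

(** * Hochschild cochains of a twisted group algebra *)

Section Simplicial.
Variables (C : fieldType) (G : Type).
Implicit Types (f : seq G -> C) (g : seq G).

(* The coboundary of the augmented complex of the full simplex on G: the empty
   list is the (-1)-simplex. *)
Fixpoint sd f g : C :=
  if g is p :: g' then f g' - sd (fun l => f (p :: l)) g' else 0.

Lemma eq_sd f f' g : (forall l, (size l).+1 = size g -> f l = f' l) -> sd f g = sd f' g.
Proof.
elim: g f f' => // p g IHg f f' eqf /=; rewrite eqf //; congr (_ - _).
by apply: IHg => l sl; rewrite eqf //= sl.
Qed.

Lemma sdD f f' g : sd (fun l => f l + f' l) g = sd f g + sd f' g.
Proof. by elim: g f f' => [|p g IHg] f f' /=; rewrite ?addr0 // IHg; ring. Qed.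

Lemma sdZ a f g : sd (fun l => a * f l) g = a * sd f g.
Proof. by elim: g f => [|p g IHg] f /=; rewrite ?mulr0 // IHg; ring. Qed.

Lemma sdB f f' g : sd (fun l => f l - f' l) g = sd f g - sd f' g.
Proof. by elim: g f f' => [|p g IHg] f f' /=; rewrite ?subr0 // IHg; ring. Qed.

Lemma sd0 g : sd (fun=> 0) g = 0.
Proof. by elim: g => [|p g IHg] //=; rewrite IHg subr0. Qed.

Lemma sd_sd f g : sd (sd f) g = 0.
Proof. by elim: g f => [|p g IHg] f //=; rewrite sdB IHg subr0 subrr. Qed.

Lemma sd_map (h : G -> G) f g : sd (fun l => f (map h l)) g = sd f (map h g).
Proof. by elim: g f => [|p g IHg] f //=; rewrite (IHg (fun l => f (h p :: l))). Qed.

(** The full simplex contracts to any of its vertices; the augmentation makes this uniform down to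
    the empty list. *)
Lemma sd_cone p f g : sd f (p :: g) = 0 -> f g = sd (fun l => f (p :: l)) g.
Proof. by move/eqP; rewrite /= subr_eq0 => /eqP. Qed.

Lemma sd_supp n f : (forall l, size l != n -> f l = 0) ->
  forall l, size l != n.+1 -> sd f l = 0.
Proof.
move=> f0 l sl; rewrite (@eq_sd _ (fun=> 0)) ?sd0 // => l' sl'.
by apply: f0; rewrite -eqSS sl'.
Qed.

End Simplicial.

Section TwistedGroupAlgebra.
Variables (C : fieldType) (G X : groupType).
Variables (pi : X -> G) (iota : G -> X) (kap : X -> C).
Hypothesis piM : {morph pi : x y / (x * y)%g}.
Hypothesis iotaK : cancel iota pi.
Hypothesis ker_central : forall u x, pi u = 1%g -> (u * x = x * u)%g.
Hypothesis kap_iota : forall g, kap (iota g) = 1.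
Hypothesis kapM : forall u x, pi u = 1%g -> kap (u * x)%g = kap u * kap x.
Hypothesis iota1 : iota 1%g = 1%g.

(** [iota x * iota y] lies over [x * y]; as [kap] is 1 on the section, it reads off the central
    discrepancy as a scalar. *)
Definition tmul (x y : G) : C * G := (kap (iota x * iota y)%g, (x * y)%g).

Local Notation b := (hoch_b 1%g tmul).
Implicit Types (phi psi : cochain C G) (F : seq G -> X -> C) (g xs : seq G) (y w u s : X).

Lemma pi1 : pi 1%g = 1%g.
Proof. by rewrite -iota1 iotaK. Qed.

Lemma piV x : pi x^-1%g = (pi x)^-1%g.
Proof. by apply: (mulgI (pi x)); rewrite -piM !mulgV pi1. Qed.

Lemma ker_split w : exists2 u, pi u = 1%g & w = (u * iota (pi w))%g.
Proof.
exists (w * (iota (pi w))^-1)%g; last by rewrite mulgVK.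
by rewrite piM piV iotaK mulgV.
Qed.

Lemma kap_mulr w x : kap (w * iota x)%g = kap w * kap (iota (pi w) * iota x)%g.
Proof.
have [u u1 {1 2}->] := ker_split w.
by rewrite -mulgA !(kapM _ u1) kap_iota mulr1.
Qed.

Lemma kap_mull w x : kap (iota x * w)%g = kap w * kap (iota x * iota (pi w))%g.
Proof.
have [u u1 {1 2}->] := ker_split w.
by rewrite mulgA -(ker_central _ u1) -mulgA !(kapM _ u1) kap_iota mulr1.
Qed.

Definition prodX xs : X := foldr (fun x acc => iota x * acc)%g 1%g xs.

Lemma prodX_cat xs xs' : prodX (xs ++ xs') = (prodX xs * prodX xs')%g.
Proof. by elim: xs => [|x xs IHxs] /=; rewrite ?mul1g // IHxs mulgA. Qed.

(** The first argument w of phi is determined by [prodX xs * w = y]: y stores the total product,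
    which contractions preserve up to central factors and conjugation. *)
Definition bar_val phi y xs : C :=
  let w := ((prodX xs)^-1 * y)%g in kap w * phi (pi w :: xs).

(* homogenize phi (g_0, ..., g_n) y is
   phi (g_n^-1 y g_0, g_0^-1 g_1, ..., g_(n-1)^-1 g_n), extended to X through kap. *)
Definition homogenize phi g y : C :=
  if g is g0 :: gs then
    bar_val phi ((iota g0)^-1 * y * iota g0)%g (pairmap (fun a c => a^-1 * c)%g g0 gs)
  else 0.

(** The faces that keep the base point g0, written in the increments: dropping an inner vertex
    multiplies two adjacent increments, dropping the last vertex drops the last increment. *)
Fixpoint inner_sd (th : seq G -> C) xs : C :=
  match xs with
  | [::] => 0
  | [:: _] => th [::]
  | x1 :: ((x2 :: xs') as xs1) =>
      th ((x1 * x2)%g :: xs') - inner_sd (fun l => th (x1 :: l)) xs1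
  end.

Lemma sd_pairmap (th : seq G -> C) (g0 : G) (gs : seq G) :
  sd (fun l => th (pairmap (fun a c => a^-1 * c)%g g0 l)) gs
  = inner_sd th (pairmap (fun a c => a^-1 * c)%g g0 gs).
Proof.
elim: gs g0 th => // g1 [|g2 gs] IHgs g0 th; first by rewrite /= subr0.
have := IHgs g1 (fun l => th ((g0^-1 * g1)%g :: l)).
rewrite [LHS]/= => H; rewrite [LHS]/= H [RHS]/=; congr (th (_ :: _) - _).
by rewrite mulgA mulgK.
Qed.

Lemma inner_sdE (th : seq G -> C) n xs : size xs = n.+1 ->
  inner_sd th xs =
  \sum_(i < n) (-1) ^+ i * th (take i xs ++ (nth 1%g xs i * nth 1%g xs i.+1)%g :: drop i.+2 xs)
  + (-1) ^+ n * th (take n xs).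
Proof.
elim: n xs th => [|n IHn] [|x1 [|x2 xs]] th //.
  by rewrite big_ord0 add0r mul1r.
move=> [sxs].
have IH := IHn (x2 :: xs) (fun l => th (x1 :: l)) (congr1 S sxs).
have -> : inner_sd th [:: x1, x2 & xs] =
  th ((x1 * x2)%g :: xs) - inner_sd (fun l => th (x1 :: l)) (x2 :: xs) by [].
rewrite {}IH big_ord_recl /= drop0 mul1r opprD addrA.
congr (_ + _ + _); last by rewrite exprS mulN1r mulNr.
by rewrite -sumrN; apply: eq_bigr => i _; rewrite /bump /= exprS mulN1r mulNr.
Qed.

(** The lift of a product and the product of the lifts differ by a central u, which homogeneity of
    [kap] turns into the structure constant of the algebra. *)
Lemma bar_val_contract phi y xs i (w := ((prodX xs)^-1 * y)%g) : (i.+1 < size xs)%N ->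
  bar_val phi y (take i xs ++ (nth 1%g xs i * nth 1%g xs i.+1)%g :: drop i.+2 xs)
  = kap w * (kap (iota (nth 1%g xs i) * iota (nth 1%g xs i.+1))%g *
      phi (pi w :: take i xs ++ (nth 1%g xs i * nth 1%g xs i.+1)%g :: drop i.+2 xs)).
Proof.
move=> li; set a := nth _ _ i; set c := nth _ _ i.+1; rewrite /bar_val /=.
set xs' := (take i xs ++ _); have [u u1] := ker_split (iota a * iota c)%g.
rewrite piM !iotaK => uE.
have xsE : prodX xs = (u * prodX xs')%g.
  rewrite -{1}(cat_take_drop i xs) (drop_nth 1%g) 1?ltnW // (drop_nth 1%g) //.
  rewrite !prodX_cat /= -/a -/c (mulgA (iota a)) uE.
  by rewrite -(mulgA u) (mulgA (prodX _) u) -(ker_central _ u1) -mulgA.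
have -> : ((prodX xs')^-1 * y = u * w)%g.
  by rewrite /w xsE invgM (ker_central _ u1) -!mulgA -(ker_central y u1) mulKg.
by rewrite uE !(kapM _ u1) kap_iota mulr1 piM u1 mul1g; ring.
Qed.

Lemma sd_homogenize phi (n : nat) (g0 : G) (gs : seq G) y
    (xs := pairmap (fun a c => a^-1 * c)%g g0 gs)
    (w := ((prodX xs)^-1 * ((iota g0)^-1 * y * iota g0))%g) : size gs = n.+1 ->
  sd (homogenize phi ^~ y) (g0 :: gs) = kap w * b phi n (pi w :: xs).
Proof.
move=> sgs; have sxs : size xs = n.+1 by rewrite size_pairmap.
rewrite [LHS]/= (sd_pairmap (bar_val phi ((iota g0)^-1 * y * iota g0)%g)) -/xs.
rewrite (inner_sdE _ sxs) /hoch_b big_ord_recl expr0 mul1r.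
rewrite opprD mulrDr mulrDr addrA; congr (_ + _ + _).
(* Dropping g0 moves the base point to g1, which conjugates y; this is the product of w with the
   first increment. *)
- case: gs sgs @xs @w {sxs} => // g1 gs _ xs w; rewrite /contract /= drop0.
  rewrite mulrA -kap_mulr /bar_val.
  have [u u1] := ker_split (iota g0 * iota (g0^-1 * g1))%g.
  rewrite piM !iotaK mulVKg => uE.
  have conjE : ((iota g1)^-1 * y * iota g1 = (iota (g0^-1 * g1))^-1 *
      ((iota g0)^-1 * y * iota g0) * iota (g0^-1 * g1))%g.
    have conjE (a z : X) : (z^-1 * a * z = a ^ z)%g by rewrite conjgE mulgA.
    rewrite !conjE -conjgM uE conjgM; congr (_ ^ _)%g.
    by rewrite conjgE -(ker_central y u1) mulKg.
  have -> : ((prodX (pairmap (fun a c : G => a^-1 * c) g1 gs))^-1 *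
     ((iota g1)^-1 * y * iota g1) = w * iota (g0^-1 * g1))%g.
    by rewrite /w conjE /= invgM !mulgA.
  by rewrite piM iotaK.
- rewrite mulr_sumr -sumrN; apply: eq_bigr => i _.
  rewrite lift0 contract_cons exprS bar_val_contract ?sxs ?ltnS //= -/w.
  ring.
(* Dropping the last vertex is the wrap-around product of the last increment with w. *)
- case/lastP: {xs} (xs) sxs @w => // xs xl; rewrite size_rcons => -[sxs] w.
  rewrite /= nth_rcons sxs ltnn eqxx -cats1 take_size_cat // /bar_val.
  have -> : ((prodX xs)^-1 * ((iota g0)^-1 * y * iota g0) = iota xl * w)%g.
    by rewrite /w -cats1 prodX_cat /= mulg1 invgM !mulgA mulgV mul1g.
  by rewrite kap_mull piM iotaK exprS; ring.
Qed.

Definition homog F := forall u g y, pi u = 1%g -> F g (u * y)%g = kap u * F g y.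
Definition transl s F g y := F [seq (pi s * h)%g | h <- g] (s * y * s^-1)%g.
Definition invar s F := forall g y, transl s F g y = F g y.

Lemma homogenize_homog phi : homog (homogenize phi).
Proof.
move=> u [|g0 gs] y u1; first by rewrite /= mulr0.
rewrite /homogenize /bar_val; set P := prodX _.
have -> : (P^-1 * ((iota g0)^-1 * (u * y) * iota g0) =
   u * (P^-1 * ((iota g0)^-1 * y * iota g0)))%g.
  rewrite (mulgA _ u y) -(ker_central (iota g0)^-1%g u1) -!(mulgA u).
  by rewrite (mulgA _ u) -(ker_central _ u1) !mulgA.
by rewrite kapM // piM u1 mul1g mulrA.
Qed.

Lemma homogenize_invar phi s : invar s (homogenize phi).
Proof.
move=> [|g0 gs] y //; rewrite /transl /homogenize /=; congr (bar_val phi _ _).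
  have [u u1] := ker_split (s * iota g0)%g; rewrite piM iotaK => uE.
  have conjE (a z : X) : (z^-1 * a * z = a ^ z)%g by rewrite conjgE mulgA.
  have -> : (s * y * s^-1 = y ^ s^-1)%g by rewrite conjgE invgK mulgA.
  rewrite !conjE -conjgM -(mulKg s (iota g0)) uE (mulgA _ u) -(ker_central _ u1).
  by rewrite -mulgA [in RHS]conjgM [(y ^ u)%g]conjgE -(ker_central y u1) mulKg.
elim: gs (g0) => //= g1 gs IHgs h0; rewrite IHgs; congr (_ :: _).
by rewrite invgM -mulgA mulKg.
Qed.

Definition dehomogenize F : cochain C G := fun x =>
  if x is x0 :: xs then F (1%g :: scanl *%g 1%g xs) (prodX xs * iota x0)%g else 0.

Lemma map_scanl (h : G) xs : [seq (h * k)%g | k <- scanl *%g 1%g xs] = scanl *%g h xs.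
Proof.
suff H (a : G) : [seq (h * k)%g | k <- scanl *%g a xs] = scanl *%g (h * a)%g xs.
  by rewrite H mulg1.
by elim: xs a => //= x xs IHxs a; rewrite IHxs mulgA.
Qed.

(** Invariance moves the base point g0 to 1, and homogeneity absorbs the choice of lift of w. *)
Lemma dehomogenizeK F (g0 : G) (gs : seq G) y : homog F -> (forall s, invar s F) ->
  homogenize (dehomogenize F) (g0 :: gs) y = F (g0 :: gs) y.
Proof.
move=> homF invF; rewrite /homogenize /bar_val /dehomogenize.
set xs := pairmap _ _ _; set y0 := (_ * y * _)%g; set w := (_ * y0)%g.
have [u u1 wE] := ker_split w.
have kw : kap w = kap u by rewrite wE kapM // kap_iota mulr1.
rewrite kw -homF // mulgA (ker_central _ u1) -mulgA -wE /w mulVKg.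
rewrite -[LHS](invF (iota g0)) /transl /= iotaK mulg1 map_scanl.
rewrite (pairmapK (_ : forall a : G, cancel _ ( *%g a))); last by move=> a; exact: mulVKg.
by rewrite /y0 -!mulgA mulgV mulg1 mulVKg.
Qed.

Lemma homogenize_bar phi x0 xs :
  homogenize phi (1%g :: scanl *%g 1%g xs) (prodX xs * iota x0)%g = phi (x0 :: xs).
Proof.
rewrite /homogenize (scanlK (_ : forall a : G, cancel _ (fun c => a^-1 * c)%g)); last exact: mulKg.
by rewrite /bar_val iota1 invg1 mul1g mulg1 mulKg iotaK kap_iota mul1r.
Qed.

Lemma sd_homogenize_bar phi n x0 xs : size xs = n.+1 ->
  sd (homogenize phi ^~ (prodX xs * iota x0)%g) (1%g :: scanl *%g 1%g xs) = b phi n (x0 :: xs).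
Proof.
move=> sxs; rewrite (@sd_homogenize _ n) ?size_scanl //.
rewrite (scanlK (_ : forall a : G, cancel _ (fun c => a^-1 * c)%g)); last exact: mulKg.
by rewrite iota1 invg1 mul1g mulg1 mulKg iotaK kap_iota mul1r.
Qed.

(** Carries an invariant simplicial primitive back to the Hochschild complex, modulo a given class
    c; a = 0 gives plain vanishing. *)
Lemma hoch_of_sd n phi c a F :
  homog F -> (forall s, invar s F) ->
  (forall g y, size g = n.+2 -> homogenize phi g y = a * homogenize c g y + sd (F ^~ y) g) ->
  exists psi, forall x, size x = n.+2 -> phi x = a * c x + b psi n x.
Proof.
move=> homF invF phiE; exists (dehomogenize F) => -[|x0 xs] // [sxs].
rewrite -(homogenize_bar phi) -(homogenize_bar c) -sd_homogenize_bar // phiE;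
  last by rewrite /= size_scanl sxs.
congr (_ + _); apply: eq_sd => -[|g0 gs]; first by rewrite /= size_scanl sxs.
by rewrite dehomogenizeK.
Qed.

Lemma sd_homogenize_cocycle n phi :
  (forall x, size x = n.+2 -> b phi n x = 0) ->
  forall g y, size g = n.+2 -> sd (homogenize phi ^~ y) g = 0.
Proof.
move=> coc [|g0 gs] y // [sgs]; rewrite (@sd_homogenize _ n) // coc ?mulr0 //=.
by rewrite size_pairmap sgs.
Qed.

End TwistedGroupAlgebra.

(** * Equivariant simplicial cochains *)

Section IntSum.
Variable C : fieldType.

(** The indefinite sum from 0, signed on negative arguments so that [isumS] holds on all of Z. *)
Definition isum (f : int -> C) (a : int) : C :=
  match a with
  | Posz n => \sum_(i < n) f (Posz i)
  | Negz n => - \sum_(i < n.+1) f (Negz i)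
  end.

Lemma isumS f a : isum f (a + 1) = isum f a + f a.
Proof.
case: a => [n|[|n]].
- have -> : Posz n + 1 = Posz n.+1 by lia.
  by rewrite /= big_ord_recr.
- by rewrite /= big_ord1 big_ord0 addNr.
- have -> : Negz n.+1 + 1 = Negz n by lia.
  by rewrite /= [in RHS]big_ord_recr /= opprD -addrA addNr addr0.
Qed.

Lemma eq_isum f f' a : f =1 f' -> isum f a = isum f' a.
Proof. by move=> eqf; case: a => n /=; [|congr (- _)]; apply: eq_bigr => i _. Qed.

Lemma isumZ c f a : isum (fun i => c * f i) a = c * isum f a.
Proof. by case: a => n /=; rewrite ?mulrN mulr_sumr. Qed.

Lemma isum0 a : isum (fun=> 0) a = 0.
Proof. by case: a => n /=; rewrite big1 ?oppr0. Qed.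
End IntSum.

Section Equivariance.
Variables (C : fieldType) (G X : groupType) (pi : X -> G) (kap : X -> C).
Hypothesis piM : {morph pi : x y / (x * y)%g}.
Hypothesis pi1 : pi 1%g = 1%g.
Hypothesis ker_central : forall u x, pi u = 1%g -> (u * x = x * u)%g.
Implicit Types (F K : seq G -> X -> C) (g : seq G) (s y : X).

Local Notation transl := (transl pi).
Local Notation invar := (invar pi).
Local Notation homog := (homog pi kap).

Definition dif s F g y := transl s F g y - F g y.
Definition sdF F g y := sd (F ^~ y) g.
(** Cochains carry all degrees at once and this isolates one of them. A list of size n is an
    (n-1)-simplex, so [supp n.+1] is Hochschild degree n. *)
Definition supp n F := forall g y, size g != n -> F g y = 0.

Lemma translM s t F g y : transl s (transl t F) g y = transl (t * s)%g F g y.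
Proof.
rewrite /transl -map_comp invgM !mulgA; congr (F _ _).
by apply: eq_map => h /=; rewrite piM mulgA.
Qed.

Lemma transl_ker u F g y : pi u = 1%g -> transl u F g y = F g y.
Proof.
move=> u1; rewrite /transl u1 (ker_central y u1) mulgK; congr (F _ _).
by rewrite -[RHS]map_id; apply: eq_map => h /=; rewrite mul1g.
Qed.

Lemma eq_transl s F F' g y : (forall g y, F g y = F' g y) -> transl s F g y = transl s F' g y.
Proof. by move=> eqF; exact: eqF. Qed.

Lemma transl_kerM u s F g y : pi u = 1%g -> transl (u * s)%g F g y = transl s F g y.
Proof. by move=> u1; rewrite -translM; apply: eq_transl => g' y'; apply: transl_ker. Qed.

Lemma invarM s t F : invar s F -> invar t F -> invar (s * t)%g F.
Proof. by move=> sF tF g y; rewrite -translM -[RHS]tF; apply: sF. Qed.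

Lemma invarV s F : invar s F -> invar s^-1%g F.
Proof.
move=> sF g y; rewrite -(transl_ker F g y pi1) -(mulgV s) -translM.
by apply: esym; apply: sF.
Qed.

Lemma sdF_transl s F g y : sdF (transl s F) g y = transl s (sdF F) g y.
Proof. exact: (sd_map (fun h => (pi s * h)%g) (F ^~ (s * y * s^-1)%g)). Qed.

Lemma homog_sdF F : homog F -> homog (sdF F).
Proof.
move=> hF u g y u1; rewrite /sdF -sdZ; apply: eq_sd => l _; exact: hF.
Qed.

Lemma homog_transl s F : homog F -> homog (transl s F).
Proof.
move=> hF u g y u1; rewrite /transl -hF //.
by rewrite (mulgA s u) -(ker_central s u1) -!mulgA.
Qed.

Lemma homogB F F' : homog F -> homog F' -> homog (fun g y => F g y - F' g y).
Proof. by move=> hF hF' u g y u1; rewrite hF // hF' // mulrBr. Qed.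

Lemma homog_cone p F : homog F -> homog (fun g y => F (p :: g) y).
Proof. by move=> hF u g y; apply: hF. Qed.

Lemma supp_sdF n F : supp n F -> supp n.+1 (sdF F).
Proof. by move=> sF g y sg; apply: (@sd_supp _ _ n) => // l; apply: sF. Qed.

Lemma supp_transl s n F : supp n F -> supp n (transl s F).
Proof. by move=> sF g y sg; apply: sF; rewrite size_map. Qed.

Lemma suppB n F F' : supp n F -> supp n F' -> supp n (fun g y => F g y - F' g y).
Proof. by move=> sF sF' g y sg; rewrite sF // sF' // subr0. Qed.

Lemma supp_cone n p F : supp n.+1 F -> supp n (fun g y => F (p :: g) y).
Proof. by move=> sF g y sg; apply: sF. Qed.

Section Direction.
Variables (t : int -> X) (ht : G -> int).
Hypothesis tD : forall i j, t (i + j) = (t i * t j)%g.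
Hypothesis t_ht : forall i h, ht (pi (t i) * h)%g = ht h + i.

(** A discrete integral of F along the t-orbit of the simplex: the j-th translate has its first
    vertex at height j, and j runs from 0 up to the height of g0. *)
Definition solve F g y : C :=
  if g is g0 :: _ then isum (fun j => transl (t (j - ht g0)) F g y) (ht g0) else 0.

(** What s must satisfy for [solve] to respect s-invariance. Commutation is asked only up to the
    kernel, since lattice translations commute in X only up to a phase. *)
Definition preserves s := (forall h, ht (pi s * h)%g = ht h) /\
  forall i, exists2 u, pi u = 1%g & (t i * s = u * (s * t i))%g.

Lemma dif_solve F g y : F [::] y = 0 -> dif (t 1) (solve F) g y = F g y.
Proof.
case: g => [|g0 g] F0; first by rewrite /dif /transl /= subrr F0.
rewrite /dif {1}/transl /= t_ht isumS addrAC.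
have t0 : t 0 = 1%g by apply: (mulgI (t 0)); rewrite -tD addr0 mulg1.
(* The summands depend on the absolute height j only, so the translated simplex gives the same sum
   with one more term, namely F. *)
have E j : transl (t (j - (ht g0 + 1))) F [seq (pi (t 1) * h)%g | h <- g0 :: g]
     (t 1 * y * (t 1)^-1)%g = transl (t (j - ht g0)) F (g0 :: g) y.
  rewrite -[LHS]/(transl _ (transl _ F) _ _) translM -tD.
  by have -> : j - (ht g0 + 1) + 1 = j - ht g0 by lia.
rewrite (eq_isum _ E) [X in _ - _ + X]E addrN add0r subrr t0.
by rewrite transl_ker.
Qed.

Lemma homog_solve F : homog F -> homog (solve F).
Proof.
move=> hF u [|g0 g] y u1 /=; first by rewrite mulr0.
rewrite -isumZ; apply: eq_isum => j; exact: homog_transl.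
Qed.

Lemma supp_solve n F : supp n F -> supp n (solve F).
Proof.
move=> sF [|g0 g] y sg //=; rewrite -(isum0 C (ht g0)); apply: eq_isum => j.
exact: (supp_transl (t (j - ht g0)) sF y sg).
Qed.

Lemma invar_solve s F : preserves s -> invar s F -> invar s (solve F).
Proof.
move=> [hts ts] sF [|g0 g] y //; rewrite /transl /= hts; apply: eq_isum => j.
rewrite -[LHS]/(transl s (transl _ F) (g0 :: g) y) translM.
have [u u1 ->] := ts (j - ht g0).
rewrite transl_kerM // -translM; exact: sF.
Qed.

(* By [dif_solve] the primitive q of the t-variation of F is itself a t-variation,
   so a coboundary correction makes F invariant under t. *)
Lemma invar_correct n F q : homog F -> supp n.+2 F -> homog q -> supp n.+1 q ->
  (forall g y, dif (t 1) F g y = sdF q g y) ->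
  exists F', [/\ homog F', supp n.+2 F', invar (t 1) F',
    forall g y, sdF F' g y = sdF F g y &
    forall s, preserves s -> invar s F -> invar s q -> invar s F'].
Proof.
move=> hF sF hq sq Fq; exists (fun g y => F g y - sdF (solve q) g y); split.
- exact/homogB/homog_sdF/homog_solve.
- exact/suppB/supp_sdF/supp_solve.
- move=> g y; apply/eqP; rewrite -subr_eq0; apply/eqP.
  transitivity (dif (t 1) F g y - (transl (t 1) (sdF (solve q)) g y - sdF (solve q) g y)).
    by rewrite /dif /transl; ring.
  rewrite Fq -sdF_transl /sdF -sdB -sdB -[RHS](sd0 C g); apply: eq_sd => l _.
  by rewrite -[X in _ - X]/(dif (t 1) (solve q) l y) dif_solve ?subrr // sq.
- by move=> g y; rewrite /sdF sdB [X in _ - X]sd_sd subr0.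
- move=> s ps sF' sq' g y; congr (_ - _); first exact: sF'.
  rewrite -[LHS]/(transl s _ g y) -sdF_transl; apply: eq_sd => l _.
  exact: invar_solve.
Qed.

End Direction.

(* Each direction imposed as an invariance costs one degree of exactness. *)
Section OneDirection.
Variables (t1 : int -> X) (ht1 : G -> int).
Hypothesis t1D : forall i j, t1 (i + j) = (t1 i * t1 j)%g.
Hypothesis t1_ht : forall i h, ht1 (pi (t1 i) * h)%g = ht1 h + i.

Lemma dif_sdF s F g y : sdF (dif s F) g y = dif s (sdF F) g y.
Proof. by rewrite /dif -sdF_transl /sdF sdB. Qed.

(** Coning at the vertex 1 loses invariance, but the t-variation of the cone is again a cocycle;
    coning it once more yields the q that [invar_correct] asks for. *)
Lemma exact1 n F : homog F -> supp n.+3 F -> invar (t1 1) F ->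
  (forall g y, sdF F g y = 0) ->
  exists F', [/\ homog F', supp n.+2 F', invar (t1 1) F' &
    forall g y, F g y = sdF F' g y].
Proof.
move=> hF sF tF dF.
pose F0 g y := F (1%g :: g) y; pose q g y := dif (t1 1) F0 (1%g :: g) y.
have hF0 : homog F0 by exact: homog_cone.
have sF0 : supp n.+2 F0 by exact: supp_cone.
have FE g y : F g y = sdF F0 g y by exact: (@sd_cone _ _ 1%g (F ^~ y) g (dF (1%g :: g) y)).
have hd : homog (dif (t1 1) F0) by apply: homogB => //; exact: homog_transl.
have sd' : supp n.+2 (dif (t1 1) F0) by apply: suppB => //; exact: supp_transl.
have dq g y : dif (t1 1) F0 g y = sdF q g y.
  apply: (@sd_cone _ _ 1%g (dif (t1 1) F0 ^~ y)).
  rewrite -[LHS]/(sdF _ _ _) dif_sdF /dif.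
  by rewrite /transl -!FE; apply/eqP; rewrite subr_eq0; apply/eqP/tF.
have [F' [hF' sF' tF' dF' _]] :=
  invar_correct t1D t1_ht hF0 sF0 (homog_cone 1%g hd) (supp_cone 1%g sd') dq.
by exists F'; split=> // g y; rewrite FE dF'.
Qed.
End OneDirection.

Section TwoDirections.
Variables (t1 t2 : int -> X) (ht1 ht2 : G -> int).
Hypothesis t1D : forall i j, t1 (i + j) = (t1 i * t1 j)%g.
Hypothesis t2D : forall i j, t2 (i + j) = (t2 i * t2 j)%g.
Hypothesis t1_ht : forall i h, ht1 (pi (t1 i) * h)%g = ht1 h + i.
Hypothesis t2_ht : forall i h, ht2 (pi (t2 i) * h)%g = ht2 h + i.
Hypothesis t1_pres : preserves t2 ht2 (t1 1).

Lemma invar_dif2 F : invar (t1 1) F -> invar (t1 1) (dif (t2 1) F).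
Proof.
move=> tF g y; congr (_ - _); last exact: tF.
rewrite -[LHS]/(transl _ (transl _ F) _ _) translM.
have [u u1 ->] := t1_pres.2 1; rewrite transl_kerM // -translM.
exact: tF.
Qed.

(** Here q must itself be t1-invariant, or else the correction along t2 would spoil the first
    direction. Obtaining q from [exact1] is what costs the extra degree. *)
Lemma exact2 n F : homog F -> supp n.+4 F -> invar (t1 1) F -> invar (t2 1) F ->
  (forall g y, sdF F g y = 0) ->
  exists F', [/\ homog F', supp n.+3 F', invar (t1 1) F', invar (t2 1) F' &
    forall g y, F g y = sdF F' g y].
Proof.
move=> hF sF t1F t2F dF.
have [F0 [hF0 sF0 tF0 FE]] := exact1 t1D t1_ht hF sF t1F dF.
have hd : homog (dif (t2 1) F0) by apply: homogB => //; exact: homog_transl.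
have sd' : supp n.+3 (dif (t2 1) F0) by apply: suppB => //; exact: supp_transl.
have dd g y : sdF (dif (t2 1) F0) g y = 0.
  rewrite dif_sdF /dif /transl -!FE.
  by apply/eqP; rewrite subr_eq0; apply/eqP/t2F.
have [q [hq sq tq dq]] := exact1 t1D t1_ht hd sd' (invar_dif2 tF0) dd.
have [F' [hF' sF' tF' dF' pF']] := invar_correct t2D t2_ht hF0 sF0 hq sq dq.
exists F'; split=> // [|g y]; first exact: pF'.
by rewrite FE dF'.
Qed.
End TwoDirections.

End Equivariance.

(** * The crystallographic groups and their central extensions *)

Definition mapp (g : mat) (v : int * int) : int * int :=
  let '(g11, g12, g21, g22) := g in
  (g11 * v.1 + g12 * v.2, g21 * v.1 + g22 * v.2).

(** The sign is that of W(v) W(w) = lambda^(symp v w / 2) W(v + w) for the Weyl-ordered monomials W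
    described at [orb_ext]. *)
Definition symp (v w : int * int) : int := v.2 * w.1 - v.1 * w.2.

Lemma mappD g v w : mapp g (v + w) = mapp g v + mapp g w.
Proof. by case: g => [[[a b] c] d]; congr (_, _) => /=; ring. Qed.

Lemma mappN g v : mapp g (- v) = - mapp g v.
Proof. by case: g => [[[a b] c] d]; congr (_, _) => /=; ring. Qed.

Lemma mapp0 g : mapp g 0 = 0.
Proof. by case: g => [[[a b] c] d]; congr (_, _) => /=; ring. Qed.

Lemma mapp1 v : mapp mat1 v = v.
Proof. by case: v => a b; congr (_, _) => /=; ring. Qed.

Lemma mapp_matmul g h v : mapp (matmul g h) v = mapp g (mapp h v).
Proof.
case: g => [[[a b] c] d]; case: h => [[[a' b'] c'] d'].
by congr (_, _) => /=; ring.
Qed.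

Lemma sympDl u v w : symp (u + v) w = symp u w + symp v w.
Proof. by rewrite /symp /=; ring. Qed.

Lemma sympDr u v w : symp w (u + v) = symp w u + symp w v.
Proof. by rewrite /symp /=; ring. Qed.

Lemma sympNr u w : symp w (- u) = - symp w u.
Proof. by rewrite /symp /=; ring. Qed.

Lemma sympNl u w : symp (- w) u = - symp w u.
Proof. by rewrite /symp /=; ring. Qed.

Lemma symp0l w : symp 0 w = 0.
Proof. by rewrite /symp /= !mul0r subrr. Qed.

Lemma symp0r w : symp w 0 = 0.
Proof. by rewrite /symp /= !mulr0 subrr. Qed.

Lemma sympvv w : symp w w = 0.
Proof. by rewrite /symp; ring. Qed.

Section Rotations.
Variable G : cycsub.
Implicit Types (j l : 'I_(ordm1 G).+1) (v w : int * int).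

Definition rotv (j : 'I_(ordm1 G).+1) : int * int -> int * int := mapp (matpow (gen G) j).

Lemma mapp_matpow g n v : mapp (matpow g n) v = iter n (mapp g) v.
Proof. by elim: n => [|n IHn]; rewrite ?mapp1 // mapp_matmul IHn. Qed.

Lemma iter_gen_ord v : iter (ordm1 G).+1 (mapp (gen G)) v = v.
Proof. by case: v G => a b []; congr (_, _) => /=; ring. Qed.

Lemma rotv0 v : rotv 0 v = v.
Proof. exact: mapp1. Qed.

Lemma rotvA j l v : rotv (j + l) v = rotv j (rotv l v).
Proof.
rewrite /rotv !mapp_matpow -iterD /=.
set f := mapp _; set N := (ordm1 G).+1.
rewrite [in RHS](divn_eq (j + l) N) [(_ * N + _)%N]addnC iterD; congr (iter _ _ _).
by elim: ((j + l) %/ N)%N => // n IHn; rewrite mulSn iterD -IHn iter_gen_ord.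
Qed.

Lemma rotvD j v w : rotv j (v + w) = rotv j v + rotv j w.
Proof. exact: mappD. Qed.

Lemma rotvN j v : rotv j (- v) = - rotv j v.
Proof. exact: mappN. Qed.

Lemma rotv_0 j : rotv j 0 = 0.
Proof. exact: mapp0. Qed.

Lemma symp_rotv j v w : symp (rotv j v) (rotv j w) = symp v w.
Proof.
rewrite /rotv !mapp_matpow; elim: (nat_of_ord j) => // n <-; rewrite !iterS.
set v' := iter _ _ v; set w' := iter _ _ w; rewrite /symp.
by case: v' w' G => a b [c d] [] /=; ring.
Qed.

(** The adjugate of 1 - g, which together with [det1m] gives an integral substitute for (1 -
    g)^-1. *)
Definition adj1m (g : mat) (v : int * int) : int * int :=
  let '(g11, g12, g21, g22) := g in
  ((1 - g22) * v.1 + g12 * v.2, g21 * v.1 + (1 - g11) * v.2).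

Definition det1m (g : mat) : int :=
  let '(g11, g12, g21, g22) := g in (1 - g11) * (1 - g22) - g12 * g21.

Lemma adj1mD g v w : adj1m g (v + w) = adj1m g v + adj1m g w.
Proof. by case: g => [[[a b] c] d]; congr (_, _) => /=; ring. Qed.

Lemma adj1mK g v : adj1m g (v - mapp g v) = (v.1 * det1m g, v.2 * det1m g).
Proof. by case: g => [[[a b] c] d]; congr (_, _) => /=; ring. Qed.

Lemma det1m_rot j : j != 0 -> det1m (matpow (gen G) j) != 0.
Proof.
by case: G j => -[[|[|[|[|[|[|j]]]]]] ltj] //= _.
Qed.

(* An equivariant choice of the integral part of (1 - gen^j)^-1 v. *)
Definition fixpt j v : int * int :=
  let g := matpow (gen G) j in
  (((adj1m g v).1 %/ det1m g)%Z, ((adj1m g v).2 %/ det1m g)%Z).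

(** (1 - g)^-1 sends w - g w to the lattice vector w, and rounding down commutes with lattice
    translations. *)
Lemma fixptD j v w : j != 0 -> fixpt j (w + v - rotv j w) = w + fixpt j v.
Proof.
move=> j0; rewrite /fixpt addrAC adj1mD adj1mK /=.
by congr (_, _); rewrite divzMDl ?det1m_rot.
Qed.

Lemma exists_rot : exists j, j != 0.
Proof.
by case: G; [exists (@Ordinal 3 1 isT)|exists (@Ordinal 4 1 isT)|exists (@Ordinal 6 1 isT)].
Qed.

(** The sum is fixed by every rotation, and 1 - g is injective for a nontrivial one. *)
Lemma rotv_sum v : \sum_j rotv j v = 0.
Proof.
have [l l0] := exists_rot; set S := \sum_j _.
have SE : rotv l S = S.
  rewrite /S (big_morph _ (rotvD l) (rotv_0 l)) [RHS](reindex_inj (addrI l)) /=.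
  by apply: eq_bigr => j _; rewrite rotvA.
have := adj1mK (matpow (gen G) l) S; rewrite -/(rotv l S) SE subrr.
have -> : adj1m (matpow (gen G) l) 0 = 0.
  by apply: (addrI (adj1m (matpow (gen G) l) 0)); rewrite -adj1mD !addr0.
case: S {SE} => a b [] /esym/eqP; rewrite mulf_eq0 (negPf (det1m_rot l0)) orbF => /eqP->.
by move=> /esym/eqP; rewrite mulf_eq0 (negPf (det1m_rot l0)) orbF => /eqP->.
Qed.

Definition orb_mul (x y : cpbasis G) : cpbasis G := (x.1 + rotv x.2 y.1, x.2 + y.2).
Definition orb_inv (x : cpbasis G) : cpbasis G := (- rotv (- x.2) x.1, - x.2).

Lemma orb_mulA : associative orb_mul.
Proof.
move=> x y z; congr (_, _) => /=; last by rewrite addrA.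
by rewrite rotvD rotvA addrA.
Qed.

Lemma orb_mul1 : left_id (cpunit G) orb_mul.
Proof. by move=> [v j]; congr (_, _); rewrite /= ?rotv0 add0r. Qed.

Lemma orb_1mul : right_id (cpunit G) orb_mul.
Proof. by move=> [v j]; congr (_, _); rewrite /= ?rotv_0 addr0. Qed.

Lemma orb_mulV : left_inverse (cpunit G) orb_inv orb_mul.
Proof. by move=> [v j]; congr (_, _); rewrite /= addNr. Qed.

Lemma orb_Vmul : right_inverse (cpunit G) orb_inv orb_mul.
Proof.
by move=> [v j]; congr (_, _); rewrite /= ?rotvN -?rotvA addrN ?rotv0 ?addrN.
Qed.

Definition ext_mul (x y : int * cpbasis G) : int * cpbasis G :=
  (x.1 + y.1 + symp x.2.1 (rotv x.2.2 y.2.1), orb_mul x.2 y.2).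
Definition ext_inv (x : int * cpbasis G) : int * cpbasis G := (- x.1, orb_inv x.2).
Definition ext_one : int * cpbasis G := (0, cpunit G).

Lemma ext_mulA : associative ext_mul.
Proof.
move=> x y z; congr (_, _) => /=; last exact: orb_mulA.
rewrite rotvD sympDl sympDr rotvA symp_rotv; ring.
Qed.

Lemma ext_mul1 : left_id ext_one ext_mul.
Proof.
by move=> [k [v j]]; congr (_, _); rewrite /= ?orb_mul1 // symp0l add0r addr0.
Qed.

Lemma ext_1mul : right_id ext_one ext_mul.
Proof.
by move=> [k [v j]]; congr (_, _); rewrite /= ?orb_1mul // rotv_0 symp0r !addr0.
Qed.

Lemma ext_mulV : left_inverse ext_one ext_inv ext_mul.
Proof.
move=> [k [v j]]; congr (_, _) => /=; last exact: orb_mulV.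
by rewrite sympNl sympvv oppr0 addNr addr0.
Qed.

Lemma ext_Vmul : right_inverse ext_one ext_inv ext_mul.
Proof.
move=> [k [v j]]; congr (_, _) => /=; last exact: orb_Vmul.
by rewrite rotvN -rotvA (addrN j) rotv0 sympNr sympvv oppr0 addrN addr0.
Qed.
End Rotations.

Definition orb (G : cycsub) : Type := cpbasis G.
HB.instance Definition _ (G : cycsub) :=
  Choice.copy (orb G) (int * int * 'I_(ordm1 G).+1)%type.
HB.instance Definition _ (G : cycsub) := isGroup.Build (orb G)
  (@orb_mulA G) (@orb_mul1 G) (@orb_1mul G) (@orb_mulV G) (@orb_Vmul G).

(* (k, (v, j)) stands for lambda^(k/2) W(v) gen^j, where W(a, b) is the Weyl-ordered
   monomial lambda^(ab/2) U1^a U2^b; with it SL(2,Z) acts by W(v) |-> W(g v). *)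
Definition orb_ext (G : cycsub) : Type := (int * cpbasis G)%type.
HB.instance Definition _ (G : cycsub) :=
  Choice.copy (orb_ext G) (int * (int * int * 'I_(ordm1 G).+1))%type.
HB.instance Definition _ (G : cycsub) := isGroup.Build (orb_ext G)
  (@ext_mulA G) (@ext_mul1 G) (@ext_1mul G) (@ext_mulV G) (@ext_Vmul G).

Section OrbifoldCohomology.
Variables (G : cycsub) (C : numFieldType) (chi : int -> C).
Hypothesis chi0 : chi 0 = 1.
Hypothesis chiD : forall k l, chi (k + l) = chi k * chi l.
(** For chi k = lambda^(k/2) this is the irrationality of theta. *)
Hypothesis chi_free : forall k, chi (k + k) = 1 -> k = 0.

Definition opi (x : orb_ext G) : orb G := x.2.
(** U1^a U2^b = lambda^(-ab/2) W(a, b): the section is the given basis, and [okap] is the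
    coefficient in it. *)
Definition oiota (x : orb G) : orb_ext G := (- (x.1.1 * x.1.2), x).
Definition okap (x : orb_ext G) : C := chi (x.1 + x.2.1.1 * x.2.1.2).

Local Notation transl := (transl opi).
Local Notation invar := (invar opi).
Local Notation homog := (homog opi okap).
Local Notation dif := (dif opi).
Implicit Types (F : seq (orb G) -> orb_ext G -> C) (g : seq (orb G)) (s y u : orb_ext G)
  (v w : int * int) (j l : 'I_(ordm1 G).+1).

Lemma opiM : {morph opi : x y / (x * y)%g}.
Proof. by []. Qed.

Lemma opi1 : opi 1%g = 1%g.
Proof. by []. Qed.

Lemma oiotaK : cancel oiota opi.
Proof. by []. Qed.

Lemma oiota1 : oiota 1%g = 1%g.
Proof. by []. Qed.

Lemma okap_iota x : okap (oiota x) = 1.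
Proof. by rewrite /okap /= addNr chi0. Qed.

Lemma opi_ker u : opi u = 1%g -> u = (u.1, cpunit G).
Proof. by case: u => k x /= ->. Qed.

Lemma ext_mulE (x y : orb_ext G) : (x * y)%g = ext_mul x y.
Proof. by []. Qed.

Lemma orb_mulE (x y : orb G) : (x * y)%g = orb_mul x y.
Proof. by []. Qed.

Lemma oker_mul u y : opi u = 1%g -> (u * y)%g = (u.1 + y.1, y.2) :> orb_ext G.
Proof.
move=> /opi_ker ->; rewrite ext_mulE; congr (_, _) => /=.
  by rewrite symp0l addr0.
exact: orb_mul1.
Qed.

Lemma oker_central u y : opi u = 1%g -> (u * y = y * u)%g.
Proof.
move=> u1; rewrite oker_mul //; rewrite (opi_ker u1) /= ext_mulE; congr (_, _) => /=.
  by rewrite rotv_0 symp0r addr0 addrC.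
exact/esym/orb_1mul.
Qed.

Lemma okapM u y : opi u = 1%g -> okap (u * y)%g = okap u * okap y.
Proof.
move=> u1; rewrite oker_mul //; rewrite (opi_ker u1) /okap /= mulr0 addr0 -chiD.
by rewrite addrA.
Qed.

Definition kz (k : int) : orb_ext G := (k, cpunit G).
Definition tz v : orb_ext G := (0, (v, 0)).
Definition rt j : orb_ext G := (0, (0, j)).
Definition t1 (i : int) : orb_ext G := tz (i, 0).
Definition t2 (i : int) : orb_ext G := tz (0, i).
Definition ht1 (x : orb G) : int := x.1.1.
Definition ht2 (x : orb G) : int := x.1.2.

Lemma tz_mul v k w j : (tz v * (k, (w, j)))%g = (k + symp v w, (v + w, j)) :> orb_ext G.
Proof. by rewrite ext_mulE; congr (_, (_, _)); rewrite /= ?rotv0 ?add0r. Qed.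

Lemma t1D i k : t1 (i + k) = (t1 i * t1 k)%g.
Proof. by rewrite tz_mul; congr (_, (_, _)); rewrite /symp /=; ring. Qed.

Lemma t2D i k : t2 (i + k) = (t2 i * t2 k)%g.
Proof. by rewrite tz_mul; congr (_, (_, _)); rewrite /symp /=; ring. Qed.

Lemma t1_ht i h : ht1 (opi (t1 i) * h)%g = ht1 h + i.
Proof. by rewrite orb_mulE /ht1 /orb_mul rotv0 /= addrC. Qed.

Lemma t2_ht i h : ht2 (opi (t2 i) * h)%g = ht2 h + i.
Proof. by rewrite orb_mulE /ht2 /orb_mul rotv0 /= addrC. Qed.

Lemma t1_pres : preserves opi t2 ht2 (t1 1).
Proof.
split=> [h|i]; first by rewrite orb_mulE /ht2 /orb_mul rotv0 /= add0r.
(* U2^i U1 = lambda^i U1 U2^i, and [kz k] stands for lambda^(k/2). *)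
exists (kz (i + i)) => //; rewrite [RHS]oker_mul // !tz_mul.
by congr (_, (_, _)); rewrite /symp /=; try ring; rewrite addrC.
Qed.

Definition zinvar F := forall v, invar (tz v) F.

Lemma zinvarI F : invar (t1 1) F -> invar (t2 1) F -> zinvar F.
Proof.
move=> i1 i2.
have int_invar (t : int -> orb_ext G) : (forall i k, t (i + k) = (t i * t k)%g) ->
    invar (t 1) F -> forall i, invar (t i) F.
  move=> tD it; have t0 : t 0 = 1%g by apply: (mulgI (t 0)); rewrite -tD addr0 mulg1.
  have itn (n : nat) : invar (t n) F.
    elim: n => [|n IHn]; first by rewrite t0 => g y; apply: transl_ker => //; exact: oker_central.
    by rewrite -addn1 PoszD tD; apply: invarM.
  move=> [n|n]; first exact: itn.
  have -> : t (Negz n) = (t n.+1)^-1%g.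
    by apply: (mulgI (t n.+1)); rewrite -tD mulgV NegzE addrN.
  apply: invarV => //; exact: oker_central.
move=> [a b].
have -> : tz (a, b) = (kz (a * b)%R * (t1 a * t2 b))%g :> orb_ext G.
  rewrite [RHS]oker_mul // tz_mul; congr (_, (_, _)); first by rewrite /symp /=; ring.
  by congr (_, _); rewrite ?addr0 ?add0r.
apply: invarM => //; last by apply: invarM => //; apply: int_invar => //; [exact: t1D|exact: t2D].
by move=> g y; apply: transl_ker => //; exact: oker_central.
Qed.

Definition avg F g y : C := (ordm1 G).+1%:R^-1 * \sum_j transl (rt j) F g y.

Lemma avg_invar F : zinvar F -> forall s, invar s (avg F).
Proof.
move=> zF [k [v j]] g y; rewrite /transl /avg; congr (_ * _).
rewrite [RHS](reindex_inj (addIr j)) /=; apply: eq_bigr => l _.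
set s : orb_ext G := (k, _).
rewrite -[LHS]/(transl s (transl (rt l) F) g y) translM //.
have -> : (rt l * s = (kz k * tz (rotv l v)) * rt (l + j)%R)%g.
  rewrite -mulgA [RHS]oker_mul // tz_mul ext_mulE; congr (_, (_, _)) => /=.
  - by rewrite symp0l symp0r !addr0 add0r.
  - by rewrite addr0 add0r.
rewrite -translM //; apply: (invarM opiM _ (zF _)) => g' y'.
by apply: transl_ker => //; exact: oker_central.
Qed.

Lemma avg_homog F : homog F -> homog (avg F).
Proof.
move=> hF u g y u1; rewrite /avg mulrCA; congr (_ * _); rewrite mulr_sumr.
apply: eq_bigr => l _; apply: homog_transl => //; exact: oker_central.
Qed.

(** An invariant F is its own average over the rotations, so averaging a lattice-invariant primitive
    makes it fully invariant. *)
Lemma invar_primitive F F' : (forall s, invar s F) -> homog F' -> zinvar F' ->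
  (forall g y, F g y = sdF F' g y) ->
  exists F'', [/\ homog F'', forall s, invar s F'' & forall g y, F g y = sdF F'' g y].
Proof.
move=> iF hF' zF' FE; exists (avg F'); split; first exact: avg_homog.
  exact: avg_invar.
move=> g y; rewrite /avg /sdF sdZ.
have -> : sd (fun h => \sum_j transl (rt j) F' h y) g = \sum_j transl (rt j) F g y.
  transitivity (\sum_j sdF (transl (rt j) F') g y); last first.
    by apply: eq_bigr => j _; rewrite sdF_transl; apply: eq_transl => *; rewrite FE.
  rewrite /sdF; move: (index_enum _) => r.
  elim: r => [|j r IHr].
    by rewrite big_nil -[RHS](sd0 C g); apply: eq_sd => l _; rewrite big_nil.
  by rewrite big_cons -IHr -sdD; apply: eq_sd => l _; rewrite big_cons.
under eq_bigr do rewrite (iF _ _ _).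
by rewrite sumr_const card_ord -[F g y *+ _]mulr_natl mulKf // pnatr_eq0.
Qed.

Lemma tzV w : (tz w)^-1%g = tz (- w).
Proof.
apply: (mulgI (tz w)); rewrite mulgV tz_mul sympNr sympvv oppr0 addr0 addrN.
by [].
Qed.

Lemma conj_tz w k v j : (tz w * (k, (v, j)) * (tz w)^-1)%g
  = (k + symp w v - symp (w + v) (rotv j w), (w + v - rotv j w, j)) :> orb_ext G.
Proof.
rewrite tzV tz_mul ext_mulE; congr (_, (_, _)) => /=.
- by rewrite rotvN sympNr addr0.
- by rewrite rotvN.
- by rewrite addr0.
Qed.

Lemma conj_rot s y : (s * y * s^-1)%g.2.2 = y.2.2.
Proof. by rewrite /= addrAC addrN add0r. Qed.

Lemma okap_kz k : okap (kz k) = chi k.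
Proof. by rewrite /okap /= mulr0 addr0. Qed.

(** * Cocycles at elliptic y, in high degree and in degree 1 *)

Lemma conj_parabolic w k v : (tz w * (k, (v, 0)) * (tz w)^-1)%g
  = (kz (symp w v + symp w v) * (k, (v, 0)))%g :> orb_ext G.
Proof.
rewrite conj_tz oker_mul // rotv0 /=; congr (_, (_, _)); last by rewrite addrAC addrN add0r.
by rewrite sympDl sympvv /symp; ring.
Qed.

(** The phase lambda^(symp w v) by which conjugation by W(w) acts on W(v). *)
Definition chi2 w v : C := chi (symp w v + symp w v).

(** The cone vertex moves with y under translations, so coning keeps lattice invariance in every
    degree. Rounding need not respect rotations; averaging repairs that. *)
Lemma exact_elliptic F : homog F -> (forall s, invar s F) ->
  (forall g y, sdF F g y = 0) -> (forall g y, y.2.2 = 0 -> F g y = 0) ->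
  exists F', [/\ homog F', forall s, invar s F' & forall g y, F g y = sdF F' g y].
Proof.
move=> hF iF dF F0.
apply: (@invar_primitive _ (fun g y => F ((fixpt y.2.2 y.2.1, 0) :: g) y)) => //.
- by move=> u g y u1; rewrite oker_mul //= -hF // oker_mul.
- move=> w g [k [v j]]; have [->|j0] := eqVneq j 0.
    by rewrite /transl !F0 // conj_rot.
  rewrite /transl -[RHS](iF (tz w)) /transl conj_tz /=; congr (F (_ :: _) _).
  by rewrite fixptD // orb_mulE; congr (_, _); rewrite /= ?rotv0 ?add0r.
- by move=> g y; exact: (@sd_cone _ _ (fixpt y.2.2 y.2.1, 0) (F ^~ y) g (dF (_ :: g) y)).
Qed.

Lemma exact_high n F : homog F -> (forall s, invar s F) -> supp n.+4 F ->
  (forall g y, sdF F g y = 0) ->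
  exists F', [/\ homog F', forall s, invar s F' & forall g y, F g y = sdF F' g y].
Proof.
move=> hF iF sF dF.
have [F' [hF' _ i1 i2 FE]] := exact2 opiM opi1 oker_central t1D t2D t1_ht t2_ht t1_pres
  hF sF (iF _) (iF _) dF.
by apply: (invar_primitive iF hF') => //; exact: zinvarI.
Qed.

Lemma sd_size1 (a : C) g : sd (fun h => (size h == 1)%:R * a) g = 0.
Proof.
have [s2|ns2] := eqVneq (size g) 2%N; last first.
  by apply: (@sd_supp _ _ 1) => // l /negPf ->; rewrite mul0r.
by case: g s2 => [|p [|q []]] //= _; rewrite subr0 subrr.
Qed.

Lemma transl_tzC v w F g y :
  transl (tz v) (transl (tz w) F) g y = transl (tz w) (transl (tz v) F) g y.
Proof.
rewrite !translM //.
have -> : (tz w * tz v = kz (symp w v + symp w v) * (tz v * tz w))%g.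
  rewrite [RHS]oker_mul // !tz_mul /=; congr (_, (_, _)); last by rewrite addrC.
  by rewrite /symp; ring.
apply: transl_kerM => //; exact: oker_central.
Qed.

Definition e1 : int * int := (1, 0).
Definition e2 : int * int := (0, 1).

Lemma chi2_eq1 v : chi2 e1 v = 1 -> chi2 e2 v = 1 -> v = 0.
Proof.
case: v => a b /chi_free; rewrite /symp /= => ha /chi_free; rewrite /symp /= => hb.
by congr (_, _); lia.
Qed.

Section Degree1.
Variable F : seq (orb G) -> orb_ext G -> C.
Hypotheses (hF : homog F) (iF : forall s, invar s F) (sF : supp 2 F)
  (dF : forall g y, sdF F g y = 0) (F0 : forall g y, y.2.2 != 0 -> F g y = 0).

Let cone1 g y := F (1%g :: g) y.
(** The obstruction to translation invariance of the cone. Since F is invariant, this variation is a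
    cocycle, so it does not depend on the vertex ([alphaE]). *)
Let alpha w y := dif (tz w) cone1 [:: 1%g] y.

Let h_cone1 : homog cone1.
Proof. exact: homog_cone. Qed.

Let cone1E g y : F g y = sdF cone1 g y.
Proof. exact: (@sd_cone _ _ 1%g (F ^~ y) g (dF (1%g :: g) y)). Qed.

Let alphaE w h y : dif (tz w) cone1 [:: h] y = alpha w y.
Proof.
have : sdF (dif (tz w) cone1) [:: 1%g; h] y = 0.
  rewrite dif_sdF /dif /transl -!cone1E; apply/eqP; rewrite subr_eq0; apply/eqP.
  exact: iF.
by rewrite /sdF /= subr0 => /eqP; rewrite subr_eq0 => /eqP.
Qed.

Let alpha_homog w u y : opi u = 1%g -> alpha w (u * y)%g = okap u * alpha w y.
Proof.
move=> u1; rewrite /alpha /dif mulrBr; congr (_ - _); last exact: h_cone1.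
apply: homog_transl => //; exact: oker_central.
Qed.

Let alpha_conj w w' k v : alpha w (tz w' * (k, (v, 0)) * (tz w')^-1)%g
  = chi2 w' v * alpha w (k, (v, 0)).
Proof. by rewrite conj_parabolic alpha_homog // okap_kz. Qed.

(** Translations commute up to the centre, so the two mixed second variations of the cone agree. *)
Let alpha_comm w w' k v :
  (chi2 w' v - 1) * alpha w (k, (v, 0)) = (chi2 w v - 1) * alpha w' (k, (v, 0)).
Proof.
have H a b : (chi2 b v - 1) * alpha a (k, (v, 0)) =
    dif (tz b) (dif (tz a) cone1) [:: 1%g] (k, (v, 0)).
  rewrite {1}/dif /transl /= !alphaE alpha_conj; ring.
rewrite !H; have := transl_tzC w w' cone1 [:: 1%g] (k, (v, 0)).
rewrite /dif /transl /= => ->; ring.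
Qed.

(** At central y the cocycle is a homomorphism from G to C. It is constant on rotation orbits, and
    these sum to 0, so in characteristic 0 it kills all translations. *)
Let alpha_central w k : alpha w (k, (0, 0)) = 0.
Proof.
set y : orb_ext G := (k, _).
have yc s : (s * y * s^-1 = y)%g by rewrite -(oker_central s (_ : opi y = 1%g)) // mulgK.
pose f h := F [:: 1%g; h] y.
have fM h h' : f (h * h')%g = f h + f h'.
  have := dF [:: 1%g; h; (h * h')%g] y; rewrite /sdF /= subr0.
  have := iF (oiota h) [:: 1%g; h'] y; rewrite /transl /= yc mulg1 => ->.
  by rewrite -/(f _) -/(f _) -/(f _) => /eqP; rewrite subr_eq0 => /eqP ->; rewrite addrC subrK.
have f1 : f 1%g = 0 by apply: (addrI (f 1%g)); rewrite -fM mulg1 addr0.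
pose fz v : C := f (v, 0).
have fzD v v' : fz (v + v') = fz v + fz v'.
  by rewrite /fz -fM orb_mulE; congr (f (_, _)); rewrite /= ?rotv0 ?addr0.
have fz_rot l v : fz (rotv l v) = fz v.
  have rE : orb_mul (rotv l v, 0) (0, l) = orb_mul (0, l) (v, 0).
    by congr (_, _); rewrite /= ?rotv0 ?addr0 ?add0r.
  apply: (addIr (f (0, l))); rewrite -[LHS]fM orb_mulE rE -orb_mulE fM.
  exact: addrC.
have fz0 v : fz v = 0.
  have : \sum_(l < (ordm1 G).+1) fz (rotv l v) = 0.
    transitivity (fz (\sum_(l < (ordm1 G).+1) rotv l v)); last by rewrite rotv_sum; exact: f1.
    by apply: (big_rec2 (fun a b => a = fz b)) => [|l a b _ ->]; [exact/esym/f1|rewrite fzD].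
  rewrite (eq_bigr (fun=> fz v)) // sumr_const card_ord => /eqP.
  by rewrite mulrn_eq0 => /eqP.
rewrite /alpha /dif /transl /= yc mulg1 -[X in X - _]/(fz w) fz0 -[X in _ - X]/(f _) f1.
by rewrite subrr.
Qed.

(** The common solution of alpha w = (chi2 w - 1) kappa for w = e1 and e2, obtained from whichever
    phase differs from 1; [alpha_comm] makes the choice consistent. *)
Let kappa y : C := if y.2.2 == 0 then
    if chi2 e1 y.2.1 != 1 then alpha e1 y / (chi2 e1 y.2.1 - 1)
    else if chi2 e2 y.2.1 != 1 then alpha e2 y / (chi2 e2 y.2.1 - 1) else 0
  else 0.

Let kappa_homog u y : opi u = 1%g -> kappa (u * y)%g = okap u * kappa y.
Proof.
move=> u1; rewrite /kappa oker_mul //= -(oker_mul y u1); case: ifP => _; last by rewrite mulr0.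
case: ifP => _; first by rewrite alpha_homog // mulrA.
by case: ifP => _; [rewrite alpha_homog // mulrA|rewrite mulr0].
Qed.

Let kappaP w k v : (w = e1 \/ w = e2) ->
  alpha w (k, (v, 0)) = (chi2 w v - 1) * kappa (k, (v, 0)).
Proof.
rewrite /kappa /=; have [r1|r1] := eqVneq (chi2 e1 v) 1; last first.
  rewrite -subr_eq0 in r1 => -[->|->] /=; first by rewrite mulrC divfK.
  by rewrite mulrA -alpha_comm mulrAC divff // mul1r.
have [r2|r2] := eqVneq (chi2 e2 v) 1; last first.
  rewrite -subr_eq0 in r2 => -[->|->] /=; last by rewrite mulrC divfK.
  by rewrite mulrA -alpha_comm mulrAC divff // mul1r.
by rewrite (chi2_eq1 r1 r2) alpha_central mulr0.
Qed.

Lemma exact_parabolic1 :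
  exists F', [/\ homog F', forall s, invar s F' & forall g y, F g y = sdF F' g y].
Proof.
pose F' g y := cone1 g y - (size g == 1)%:R * kappa y.
have iF' w : w = e1 \/ w = e2 -> invar (tz w) F'.
  move=> ew g [k [v j]]; rewrite /transl /F' size_map.
  have [->|j0] := eqVneq j 0; last first.
    by rewrite /cone1 /kappa conj_rot [(k, (v, j)).2.2]/= (negPf j0) !F0 ?conj_rot.
  case: g => [|h [|h' g]]; rewrite ?mul0r ?subr0 ?mul1r.
  - by rewrite /cone1 !sF.
  - apply/eqP; rewrite -subr_eq0; apply/eqP.
    transitivity (dif (tz w) cone1 [:: h] (k, (v, 0))
       - (kappa (tz w * (k, (v, 0)) * (tz w)^-1)%g - kappa (k, (v, 0)))).
      by rewrite /dif /transl /=; ring.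
    rewrite alphaE kappaP // conj_parabolic kappa_homog // okap_kz -/(chi2 w v); ring.
  - by rewrite /cone1 !sF.
apply: (@invar_primitive _ F') => //.
- apply: homogB => // u g y u1; rewrite kappa_homog //; ring.
- by apply: zinvarI; apply: iF'; [left|right].
- by move=> g y; rewrite cone1E /sdF /F' sdB sd_size1 subr0.
Qed.
End Degree1.

End OrbifoldCohomology.

(** * The area cocycle and the obstruction in degree 2 *)

Section AreaCocycle.
Variables (G : cycsub) (C : numFieldType) (chi : int -> C).
Hypothesis chi0 : chi 0 = 1.
Hypothesis chiD : forall k l, chi (k + l) = chi k * chi l.
Hypothesis chi_free : forall k, chi (k + k) = 1 -> k = 0.

Local Notation transl := (transl (@opi G)).
Local Notation invar := (invar (@opi G)).
Local Notation homog := (homog (@opi G) (okap chi)).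
Local Notation dif := (dif (@opi G)).
Local Notation chi2 := (chi2 chi).
Local Notation okap := (@okap G C chi).
Implicit Types (F : seq (orb G) -> orb_ext G -> C) (g : seq (orb G)) (s y u : orb_ext G)
  (v w : int * int) (j l : 'I_(ordm1 G).+1) (h : orb G).

Definition cx h : C := (ht1 h)%:~R.
Definition cy h : C := (ht2 h)%:~R.

Definition pos1 g : C := if g is [:: h] then cx h else 0.
Definition len1 g : C := if g is [:: h; h'] then cx h' - cx h else 0.
(* A primitive of [area] that is invariant along the first direction only. *)
Definition trap g : C :=
  if g is [:: h; h'] then - (cy h + cy h') * (cx h' - cx h) else 0.
Definition area g : C := if g is [:: h; h'; h''] then
  (cx h' - cx h) * (cy h'' - cy h) - (cx h'' - cx h) * (cy h' - cy h) else 0.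

Lemma sd_pos1 g : sd pos1 g = len1 g.
Proof.
have [s2|ns2] := eqVneq (size g) 2%N; last first.
  rewrite (@sd_supp _ _ 1) //; first by case: g ns2 => [|p [|q []]].
  by case=> [|? []].
by case: g s2 => [|p [|q []]] //= _; rewrite subr0.
Qed.

Lemma sd_trap g : sd trap g = area g.
Proof.
have [s3|ns3] := eqVneq (size g) 3%N; last first.
  rewrite (@sd_supp _ _ 2) //; first by case: g ns3 => [|p [|q [|r []]]].
  by case=> [|? [|? []]].
by case: g s3 => [|p [|q [|r []]]] //= _; ring.
Qed.

Lemma cx_tz w h : cx (opi (tz G w) * h)%g = w.1%:~R + cx h.
Proof. by rewrite /cx /ht1 orb_mulE /orb_mul rotv0 /= intrD. Qed.

Lemma cy_tz w h : cy (opi (tz G w) * h)%g = w.2%:~R + cy h.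
Proof. by rewrite /cy /ht2 orb_mulE /orb_mul rotv0 /= intrD. Qed.

Lemma len1_tz w g : len1 [seq (opi (tz G w) * h)%g | h <- g] = len1 g.
Proof. by case: g => [|p [|q []]] //=; rewrite !cx_tz; ring. Qed.

Lemma trap_tz1 g : trap [seq (opi (tz G e1) * h)%g | h <- g] = trap g.
Proof. by case: g => [|p [|q []]] //=; rewrite !cx_tz !cy_tz /=; ring. Qed.

(** The defect is a multiple of [len1], the coboundary of [pos1]. This is the shape of obstruction
    that area can absorb at central y. *)
Lemma trap_tz2 g : trap [seq (opi (tz G e2) * h)%g | h <- g] = trap g - 2 * len1 g.
Proof.
by case: g => [|p [|q [|r g]]] //=; rewrite ?mulr0 ?subr0 // !cx_tz !cy_tz /=; ring.
Qed.

Lemma area_mul (s : orb G) g : area [seq (s * h)%g | h <- g] = area g.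
Proof.
have E (x y z : orb G) : area [:: x; y; z] = (symp (z.1 - x.1) (y.1 - x.1))%:~R.
  by rewrite /area /cx /cy /ht1 /ht2 /symp /= !(rmorphB, rmorphM) /=; ring.
case: g => [|p [|q [|r []]]] //.
rewrite -[LHS]/(area [:: (s * p)%g; (s * q)%g; (s * r)%g]) !E.
have B (x y : orb G) : (s * x)%g.1 - (s * y)%g.1 = rotv s.2 (x.1 - y.1).
  by rewrite !orb_mulE /= opprD addrACA subrr add0r -rotvN -rotvD.
by rewrite !B symp_rotv.
Qed.

Definition area_coch g y : C := if opi y == 1%g then okap y * area g else 0.

Lemma opi_conj s y : (opi (s * y * s^-1)%g == 1%g) = (opi y == 1%g).
Proof.
rewrite !opiM -[opi s^-1%g]/((opi s)^-1)%g divg_eq mul1g -{2}(mulg1 (opi s)).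
by rewrite (inj_eq (mulgI _)).
Qed.

Lemma area_coch_homog : homog area_coch.
Proof.
move=> u g y u1; rewrite /area_coch opiM u1 mul1g okapM //.
by case: ifP => _; rewrite ?mulr0 // mulrA.
Qed.

Lemma area_coch_invar s : invar s area_coch.
Proof.
move=> g y; rewrite /transl /area_coch opi_conj area_mul; case: eqP => // y1.
by rewrite -(oker_central s y1) mulgK.
Qed.

Lemma sdF_area_coch g y : sdF area_coch g y = 0.
Proof.
rewrite /sdF /area_coch; case: (opi y == 1%g); last by rewrite sd0.
rewrite sdZ (_ : sd area g = 0) ?mulr0 // -(sd_sd trap g).
by apply: eq_sd => l _; rewrite sd_trap.
Qed.

Section Degree2.
Variable F1 : seq (orb G) -> orb_ext G -> C.
Hypotheses (h1 : homog F1) (s1 : supp 2 F1) (i1 : invar (tz G e1) F1)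
  (p1 : forall g y, y.2.2 != 0 -> F1 g y = 0)
  (d1 : forall g y, dif (tz G e2) (sdF F1) g y = 0).

Let q g y := dif (tz G e2) F1 (1%g :: g) y.
(** If the primitive q of the t2-variation were t1-invariant, [invar_correct] would finish. Its
    t1-variation alpha, again independent of the vertex, is the obstruction. *)
Let alpha y := dif (tz G e1) q [:: 1%g] y.

Let qE g y : dif (tz G e2) F1 g y = sdF q g y.
Proof.
apply: (@sd_cone _ _ 1%g (dif (tz G e2) F1 ^~ y) g).
by rewrite -[LHS]/(sdF _ _ _) dif_sdF.
Qed.

Let q_homog : homog q.
Proof.
apply: homog_cone; apply: homogB => //; apply: homog_transl => //; exact: oker_central.
Qed.

Let q_supp : supp 1 q.
Proof. by apply: supp_cone; apply: suppB => //; exact: supp_transl. Qed.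

Let q_parabolic g y : y.2.2 != 0 -> q g y = 0.
Proof. by move=> y0; rewrite /q /dif /transl !p1 ?conj_rot ?subrr. Qed.

Let alphaE h y : dif (tz G e1) q [:: h] y = alpha y.
Proof.
have : sdF (dif (tz G e1) q) [:: 1%g; h] y = 0.
  rewrite dif_sdF /dif /transl -!qE; apply/eqP; rewrite subr_eq0; apply/eqP.
  by apply: (invar_dif2 (@opiM G) (@oker_central G) (@t1_pres G)).
by rewrite /sdF /= subr0 => /eqP; rewrite subr_eq0 => /eqP.
Qed.

Let alpha_homog u y : opi u = 1%g -> alpha (u * y)%g = okap u * alpha y.
Proof.
move=> u1; rewrite /alpha /dif mulrBr; congr (_ - _); last exact: q_homog.
apply: homog_transl => //; exact: oker_central.
Qed.

Let alpha_parabolic y : y.2.2 != 0 -> alpha y = 0.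
Proof. by move=> y0; rewrite /alpha /dif /transl !q_parabolic ?conj_rot ?subrr. Qed.

Let coef (f : int * int -> C) y : C := f y.2.1 * alpha y.

Let coef_homog f u y : opi u = 1%g -> coef f (u * y)%g = okap u * coef f y.
Proof. by move=> u1; rewrite /coef alpha_homog // oker_mul //; ring. Qed.

Let coef_conj f w y : coef f (tz G w * y * (tz G w)^-1)%g = chi2 w y.2.1 * coef f y.
Proof.
case: y => k [v j]; have [->|j0] := eqVneq j 0; last first.
  by rewrite /coef !alpha_parabolic ?conj_rot // !mulr0.
by rewrite conj_parabolic coef_homog // okap_kz.
Qed.

(* alpha is absorbed by a constant where t1 acts nontrivially on y, by len1 where
   only t2 does, and survives as a multiple of the area cocycle at y central. *)
Let fk v : C := if chi2 e1 v != 1 then (chi2 e1 v - 1)^-1 else 0.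
Let fa v : C := if chi2 e1 v == 1 then 1 else 0.
Let fb v : C := if (chi2 e1 v == 1) && (chi2 e2 v != 1) then (chi2 e2 v - 1)^-1 else 0.
(** The 1/2 compensates the factor 2 in [trap_tz2]. *)
Let fd v : C := if v == 0 then 2^-1 else 0.

Let chi2_0 w : chi2 w 0 = 1.
Proof. by rewrite /chi2 symp0r addr0 chi0. Qed.

Let fkP v : fk v * (chi2 e1 v - 1) + fa v = 1.
Proof.
rewrite /fk /fa; case: eqVneq => [->|r1]; first by rewrite subrr mulr0 add0r.
by rewrite addr0 mulVf // subr_eq0.
Qed.

Let faP v : fa v * (chi2 e1 v - 1) = 0.
Proof. by rewrite /fa; case: eqVneq => [->|r1]; rewrite ?subrr ?mulr0 ?mul0r. Qed.

Let fbP v : fb v * (chi2 e1 v - 1) = 0.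
Proof. by rewrite /fb; case: (eqVneq _ 1) => [->|r1] /=; rewrite ?subrr ?mulr0 ?mul0r. Qed.

Let fdP w v : fd v * (chi2 w v - 1) = 0.
Proof. by rewrite /fd; case: eqVneq => [->|r1]; rewrite ?chi2_0 ?subrr ?mulr0 ?mul0r. Qed.

Let fabd v : fb v * (chi2 e2 v - 1) + 2 * fd v = fa v.
Proof.
rewrite /fa /fb /fd; case: (eqVneq (chi2 e1 v) 1) => [r1|r1] /=; last first.
  rewrite mul0r; case: eqVneq => [v0|_]; last by rewrite mulr0 addr0.
  by rewrite v0 chi2_0 eqxx in r1.
case: (eqVneq (chi2 e2 v) 1) => [r2|r2] /=.
  by rewrite (chi2_eq1 chi_free r1 r2) eqxx mul0r add0r divff // pnatr_eq0.
case: eqVneq => [v0|_]; first by rewrite v0 chi2_0 eqxx in r2.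
by rewrite mulr0 addr0 mulVf // subr_eq0.
Qed.

(** [pos1] grows by 1 under t1, so it absorbs alpha where t1 fixes y. This adds a multiple of [len1]
    to the coboundary of q1, and F2 is built so that its t2-variation changes by the same amount. *)
Let q1 g y := q g y - (size g == 1)%:R * coef fk y - coef fa y * pos1 g.
Let F2 g y := F1 g y - coef fb y * len1 g + coef fd y * trap g.

Let q1_invar : invar (tz G e1) q1.
Proof.
move=> g y; apply/eqP; rewrite -subr_eq0; apply/eqP; rewrite /q1 /transl size_map.
have [sg|sg] := eqVneq (size g) 1%N; last first.
  rewrite !q_supp ?size_map // mul0r !subr0.
  by case: g sg => [|p [|p' g]] //= _; rewrite !mulr0 mul0r !subr0.
case: g sg => [|h []] //= _.
transitivity (dif (tz G e1) q [:: h] y -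
   (coef fk (tz G e1 * y * (tz G e1)^-1)%g - coef fk y) -
   (coef fa (tz G e1 * y * (tz G e1)^-1)%g * (1 + cx h) - coef fa y * cx h)).
  by rewrite /dif /transl /= cx_tz (_ : e1.1%:~R = 1 :> C) //; ring.
rewrite alphaE !coef_conj /coef.
have := fkP y.2.1; have := faP y.2.1.
set r := chi2 _ _; set a := fa _; set k := fk _ => ra /(congr1 (fun z => z * alpha y)).
rewrite mul1r => {1}<-.
have -> : a * alpha y * cx h = (a + a * (r - 1)) * alpha y * cx h by rewrite ra addr0.
have -> : (k * (r - 1) + a) * alpha y = (k * (r - 1) + a + a * (r - 1)) * alpha y.
  by rewrite ra addr0.
ring.
Qed.

Let F2_invar : invar (tz G e1) F2.
Proof.
move=> g y; rewrite /F2 /transl len1_tz trap_tz1; congr (_ - _ * _ + _ * _).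
- exact: i1.
- rewrite coef_conj /coef; apply/eqP; rewrite -subr_eq0 mulrA -mulrBl -{2}[fb _]mul1r.
  by rewrite -mulrBl mulrC [_ * fb _]mulrC fbP mulr0.
- rewrite coef_conj /coef; apply/eqP; rewrite -subr_eq0 mulrA -mulrBl -{2}[fd _]mul1r.
  by rewrite -mulrBl mulrC [_ * fd _]mulrC fdP mulr0.
Qed.

Let F2_dif g y : dif (tz G e2) F2 g y = sdF q1 g y.
Proof.
have -> : sdF q1 g y = dif (tz G e2) F1 g y - coef fa y * len1 g.
  by rewrite /sdF /q1 sdB (sdB (q ^~ y)) sd_size1 subr0 sdZ sd_pos1 -[X in X - _]/(sdF q g y) -qE.
rewrite /F2 /dif /transl len1_tz trap_tz2 !coef_conj /coef.
have := fdP e2 y.2.1; have := fabd y.2.1.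
set r := chi2 _ _; set d := fd _; set b := fb _ => <- rd.
have -> : r * (d * alpha y) = d * alpha y + d * (r - 1) * alpha y by ring.
rewrite rd mul0r addr0; ring.
Qed.

Lemma parabolic_deg2 : exists a F', [/\ homog F', invar (tz G e1) F', invar (tz G e2) F' &
  forall g y, sdF F1 g y = a * area_coch g y + sdF F' g y].
Proof.
have hF2 : homog F2.
  by move=> u g y u1; rewrite /F2 h1 // !coef_homog //; ring.
have sF2 : supp 2 F2.
  move=> g y sg; rewrite /F2 s1 //.
  by case: g sg => [|? [|? []]] //=; rewrite !mulr0 subrr addr0.
have hq1 : homog q1.
  by move=> u g y u1; rewrite /q1 q_homog // !coef_homog //; ring.
have sq1 : supp 1 q1.
  move=> g y sg; rewrite /q1 q_supp // (negPf sg).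
  by case: g sg => [|? []] //= *; rewrite !mulr0 mul0r !subr0.
have [F' [hF' _ i2 dF' pF']] := invar_correct (@opiM G) (@opi1 G) (@oker_central G)
  (@t2D G) (@t2_ht G) hF2 sF2 hq1 sq1 F2_dif.
(* Passing from F1 to F2 adds a multiple of [trap], whose coboundary is alpha(1)/2 times the area at
   central y; hence the coefficient and its sign. *)
exists (- (alpha 1%g / 2)), F'; split=> // [|g y].
  by apply: pF' => //; exact: t1_pres.
rewrite dF'.
have -> : sdF F2 g y = sdF F1 g y + coef fd y * area g.
  rewrite /sdF /F2 sdD sdB !sdZ sd_trap.
  rewrite [sd len1 g](_ : _ = 0) ?mulr0 ?subr0 //.
  by rewrite -(sd_sd pos1 g); apply: eq_sd => l _; rewrite sd_pos1.
suff -> : coef fd y * area g = alpha 1%g / 2 * area_coch g y by ring.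
rewrite /area_coch /coef /fd; case: y => k [v j] /=.
have [j0|j0] := eqVneq j 0; last first.
  rewrite alpha_parabolic // mulr0 mul0r; case: eqP => [[_ /eqP]|_]; last by rewrite mulr0.
  by rewrite (negPf j0).
case: eqVneq => [v0|v0].
  rewrite ifT; last by rewrite v0 j0.
  have -> : (k, (v, j)) = (kz G k * 1)%g by rewrite oker_mul // v0 j0 addr0.
  by rewrite alpha_homog // okapM // (_ : okap 1%g = 1) ?mulr1; [ring|rewrite /okap /= mulr0 addr0].
rewrite ifF ?mulr0 ?mul0r //; apply/eqP => -[vE _].
by rewrite vE eqxx in v0.
Qed.
End Degree2.

End AreaCocycle.

(** * Hochschild cohomology of the twisted group algebra *)

Section OrbifoldHochschild.
Variables (G : cycsub) (C : numFieldType) (chi : int -> C).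
Hypothesis chi0 : chi 0 = 1.
Hypothesis chiD : forall k l, chi (k + l) = chi k * chi l.
Hypothesis chi_free : forall k, chi (k + k) = 1 -> k = 0.

Local Notation invar := (invar (@opi G)).
Local Notation homog := (homog (@opi G) (okap chi)).
Local Notation chi2 := (chi2 chi).
Local Notation okap := (@okap G C chi).
Local Notation area_coch := (@area_coch G C chi).
Local Notation homogenize := (homogenize (@opi G) (@oiota G) okap).
Local Notation b := (hoch_b 1%g (tmul (@oiota G) okap)).
Implicit Types (F : seq (orb G) -> orb_ext G -> C) (g : seq (orb G)) (s y u : orb_ext G).

Definition parab F g y : C := if y.2.2 == 0 then F g y else 0.

Lemma parab_homog F : homog F -> homog (parab F).
Proof.
move=> hF u g y u1; rewrite /parab {1}oker_mul //=.
by case: ifP => _; rewrite ?mulr0 // hF.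
Qed.

Lemma parab_invar s F : invar s F -> invar s (parab F).
Proof.
move=> iF g y; rewrite /transl /parab conj_rot; case: ifP => // _; exact: iF.
Qed.

Lemma parab_supp n F : supp n F -> supp n (parab F).
Proof. by move=> sF g y sg; rewrite /parab sF // if_same. Qed.

Lemma sdF_parab F g y : sdF (parab F) g y = parab (sdF F) g y.
Proof. by rewrite /sdF /parab; case: (y.2.2 == 0); rewrite ?sd0. Qed.

Lemma exact_nonparab F : homog F -> (forall s, invar s F) -> (forall g y, sdF F g y = 0) ->
  exists F', [/\ homog F', forall s, invar s F' &
    forall g y, F g y - parab F g y = sdF F' g y].
Proof.
move=> hF iF dF; apply: exact_elliptic => //.
- by apply: homogB => //; exact: parab_homog.
- by move=> s g y; congr (_ - _); [exact: iF|exact: (parab_invar (iF s))].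
- by move=> g y; rewrite /sdF sdB -!/(sdF _ g y) sdF_parab /parab dF if_same subrr.
- by move=> g y y0; rewrite /parab y0 eqxx subrr.
Qed.

Lemma exact_deg1 F : homog F -> (forall s, invar s F) -> supp 2 F ->
  (forall g y, sdF F g y = 0) ->
  exists F', [/\ homog F', forall s, invar s F' & forall g y, F g y = sdF F' g y].
Proof.
move=> hF iF sF dF.
have [Fe [hFe iFe FeE]] := exact_nonparab hF iF dF.
have [Fp [hFp iFp FpE]] : exists F', [/\ homog F', forall s, invar s F' &
    forall g y, parab F g y = sdF F' g y].
  apply: (exact_parabolic1 chi_free) => //.
  - exact: parab_homog.
  - by move=> s; apply: parab_invar.
  - exact: parab_supp.
  - by move=> g y; rewrite sdF_parab /parab dF if_same.
  - by move=> g y y0; rewrite /parab (negPf y0).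
exists (fun g y => Fe g y + Fp g y); split.
- by move=> u g y u1; rewrite hFe // hFp // mulrDr.
- by move=> s g y; congr (_ + _); [exact: iFe|exact: iFp].
- by move=> g y; rewrite /sdF sdD -!/(sdF _ g y) -FeE -FpE subrK.
Qed.

(** The degree is too low for [exact2]: only one direction can be imposed freely, and
    [parabolic_deg2] measures what the second one leaves over. *)
Lemma exact_deg2 F : homog F -> (forall s, invar s F) -> supp 3 F ->
  (forall g y, sdF F g y = 0) ->
  exists a F', [/\ homog F', forall s, invar s F' &
    forall g y, F g y = a * area_coch g y + sdF F' g y].
Proof.
move=> hF iF sF dF.
have [Fe [hFe iFe FeE]] := exact_nonparab hF iF dF.
have [F1 [hF1 sF1 i1 FE]] : exists F1, [/\ homog F1, supp 2 F1, invar (t1 G 1) F1 &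
    forall g y, F g y = sdF F1 g y].
  exact: (exact1 (@opiM G) (@opi1 G) (@oker_central G) (@t1D G) (@t1_ht G) hF sF (iF _) dF).
have FpE g y : parab F g y = sdF (parab F1) g y.
  by rewrite sdF_parab /parab FE.
have pF1 g y : y.2.2 != 0 -> parab F1 g y = 0 by move=> y0; rewrite /parab (negPf y0).
have dF1 g y : dif (@opi G) (tz G e2) (sdF (parab F1)) g y = 0.
  rewrite /dif /transl -!FpE; apply/eqP; rewrite subr_eq0; apply/eqP.
  exact: (parab_invar (iF (tz G e2))).
have [a [F2 [hF2 i21 i22 F2E]]] := parabolic_deg2 chi0 chiD chi_free
  (parab_homog hF1) (parab_supp sF1) (parab_invar i1) pF1 dF1.
have [Fp [hFp iFp FpE']] : exists F', [/\ homog F', forall s, invar s F' &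
    forall g y, parab F g y - a * area_coch g y = sdF F' g y].
  apply: (invar_primitive (F' := F2)) => //.
  - move=> s g y; congr (_ - _ * _); last exact: area_coch_invar.
    exact: (parab_invar (iF s)).
  - by apply: zinvarI.
  - by move=> g y; rewrite FpE F2E // addrC addKr.
exists a, (fun g y => Fe g y + Fp g y); split.
- by move=> u g y u1; rewrite hFe // hFp // mulrDr.
- by move=> s g y; congr (_ + _); [exact: iFe|exact: iFp].
- by move=> g y; rewrite /sdF sdD -!/(sdF _ g y) -FeE -FpE'; ring.
Qed.

(** Only the values of phi on lists of one size matter; cutting off the others makes the cocycle
    condition hold on lists of every size. *)
Definition sized n (phi : cochain C (orb G)) g y : C :=
  if size g == n then homogenize phi g y else 0.

Lemma sized_homog n phi : homog (sized n phi).
Proof.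
move=> u g y u1; rewrite /sized; case: ifP => _; last by rewrite mulr0.
exact: (homogenize_homog (@oiota G) (@opiM G) (@oker_central G) (okapM chiD)).
Qed.

Lemma sized_invar n phi s : invar s (sized n phi).
Proof.
move=> g y; rewrite /transl /sized size_map; case: ifP => // _.
exact: (homogenize_invar okap (@opiM G) (@oiotaK G) (@oker_central G) (@oiota1 G)).
Qed.

Lemma sized_supp n phi : supp n (sized n phi).
Proof. by move=> g y sg; rewrite /sized (negPf sg). Qed.

Lemma sized_cocycle n phi : (forall x, size x = n.+3 -> b phi n.+1 x = 0) ->
  forall g y, sdF (sized n.+2 phi) g y = 0.
Proof.
move=> coc g y; have [sg|sg] := eqVneq (size g) n.+3; last first.
  by apply: (supp_sdF (@sized_supp n.+2 phi)).
rewrite -(@sd_homogenize_cocycle _ _ _ (@opi G) (@oiota G) okap (@opiM G) (@oiotaK G)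
  (@oker_central G) (okap_iota chi0) (okapM chiD) (@oiota1 G) _ _ coc g y sg).
by apply: eq_sd => l /eqP; rewrite sg eqSS /sized => ->.
Qed.

Lemma hoch_vanish_orb n (phi : cochain C (orb G)) : n.+1 != 2%N ->
  (forall x, size x = n.+3 -> b phi n.+1 x = 0) ->
  exists psi, forall x, size x = n.+2 -> phi x = b psi n x.
Proof.
move=> n1 /sized_cocycle dF.
have [F' [hF' iF' FE]] : exists F', [/\ homog F', forall s, invar s F' &
    forall g y, sized n.+2 phi g y = sdF F' g y].
  have hs := @sized_homog n.+2 phi; have inv := @sized_invar n.+2 phi.
  have ss := @sized_supp n.+2 phi.
  case: n n1 dF hs inv ss => [|[|n]] // _ dF hs inv ss; first exact: exact_deg1.
  exact: (exact_high (n := n)).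
have phiE g y : size g = n.+2 -> homogenize phi g y = 0 * homogenize (fun=> 0) g y + sd (F' ^~ y) g.
  by move=> sg; rewrite mul0r add0r -[RHS]FE /sized sg eqxx.
have [psi psiE] := hoch_of_sd (@opiM G) (@oiotaK G)
  (@oker_central G) (okap_iota chi0) (okapM chiD) (@oiota1 G) hF' iF' phiE.
by exists psi => x sx; rewrite psiE // mul0r add0r.
Qed.

Definition area_cocycle : cochain C (orb G) := dehomogenize (@oiota G) area_coch.

Lemma homogenize_area g y : size g != 0%N -> homogenize area_cocycle g y = area_coch g y.
Proof.
case: g => // g0 gs _; apply: (dehomogenizeK (@opiM G) (@oiotaK G)) => //.
- exact: oker_central.
- exact: okap_iota.
- exact: okapM.
- exact: area_coch_homog.
- exact: area_coch_invar.
Qed.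

Lemma hoch_deg2_orb phi : (forall x, size x = 4%N -> b phi 2 x = 0) ->
  exists a psi, forall x, size x = 3%N -> phi x = a * area_cocycle x + b psi 1 x.
Proof.
move=> /sized_cocycle dF.
have [a [F' [hF' iF' FE]]] := exact_deg2 (@sized_homog 3 phi) (@sized_invar 3 phi)
  (@sized_supp 3 phi) dF.
exists a; apply: (@hoch_of_sd _ _ _ (@opi G) (@oiota G) okap (@opiM G) (@oiotaK G)
  (@oker_central G) (okap_iota chi0) (okapM chiD) (@oiota1 G) 1 phi area_cocycle a F' hF' iF').
by move=> g y sg; rewrite homogenize_area ?sg // -[RHS]FE /sized sg eqxx.
Qed.

Lemma area_cocycleP x : size x = 4%N -> b area_cocycle 2 x = 0.
Proof.
case: x => // x0 xs [sxs].
rewrite -(sd_homogenize_bar (@opiM G) (@oiotaK G) (@oker_central G) (okap_iota chi0) (okapM chiD)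
   (@oiota1 G)) //.
rewrite -[RHS](sdF_area_coch chi (1%g :: scanl *%g 1%g xs)
  (prodX (@oiota G) xs * oiota x0)%g).
by apply: eq_sd => l sl; rewrite homogenize_area //; move: sl; rewrite /= size_scanl sxs => -[->].
Qed.

(** Inserting a unit degenerates the triangle: at the end it repeats a vertex, and in front the
    condition that the total product be 1 makes the last vertex equal to the first. *)
Lemma conB_area_cocycle x : size x = 2%N -> conB 1%g area_cocycle 1 x = 0.
Proof.
move=> sx; rewrite /conB big1 // => i _; rewrite /conB0.
have : size (rot i x) = 2%N by rewrite size_rot.
case: (rot i x) => [|x0 [|x1 []]] // _.
have E1 : area_cocycle [:: 1%g; x0; x1] = 0.
  rewrite /area_cocycle /dehomogenize /area_coch; case: eqP => // E.
  have {}E : (x0 * x1)%g = 1%g.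
    by have : (x0 * (x1 * 1) * 1)%g = 1%g := E; rewrite !mulg1.
  rewrite [scanl _ _ _]/= !mul1g E /area; ring.
have E2 : area_cocycle [:: x0; x1; 1%g] = 0.
  rewrite /area_cocycle /dehomogenize /area_coch; case: eqP => // E.
  rewrite [scanl _ _ _]/= !mul1g mulg1 /area; ring.
by rewrite [rcons _ _]/= E1 E2 mulr0 subrr mulr0.
Qed.

(** A pairing with the fundamental class of the torus. At y = 1 a coboundary is symmetric in the
    commuting translations d1 and d2, while the two triangles filling the unit square have values 1
    and -1. *)
Lemma area_cocycle_nontrivial a psi :
  (forall x, size x = 3%N -> a * area_cocycle x = b psi 1 x) -> a = 0.
Proof.
move=> aE.
pose d1 : orb G := (e1, 0); pose d2 : orb G := (e2, 0).
pose f h := homogenize psi [:: 1%g; h] 1%g.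
have inv h k : homogenize psi [:: h; (h * k)%g] 1%g = f k.
  have : homogenize psi [:: (h * 1)%g; (h * k)%g] (oiota h * 1 * (oiota h)^-1)%g = f k.
    exact: (homogenize_invar okap (@opiM G) (@oiotaK G) (@oker_central G) (@oiota1 G)
      psi (oiota h) [:: 1%g; k] 1%g).
  by rewrite !mulg1 mulgV.
have main h k : a * area_coch [:: 1%g; h; (h * k)%g] 1%g = f k - f (h * k)%g + f h.
  rewrite -homogenize_area //.
  have := @sd_homogenize _ _ _ _ _ _ (@opiM G) (@oiotaK G) (@oker_central G) (okap_iota chi0)
    (okapM chiD) (@oiota1 G) psi 1 1%g [:: h; (h * k)%g] 1%g erefl.
  rewrite -aE ?size_pairmap // mulrCA => <-.
  have sdE (k3 : seq (orb G) -> C) (x y z : orb G) :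
      sd k3 [:: x; y; z] = k3 [:: y; z] - (k3 [:: x; z] - (k3 [:: x; y] - 0)) by [].
  by rewrite sdE inv -/(f _) -/(f _); ring.
have ar (x y : orb G) : area_coch [:: 1%g; x; y] 1%g = area C [:: 1%g; x; y].
  by rewrite /area_coch eqxx (_ : okap 1%g = 1) ?mul1r // /okap /= mulr0 addr0.
have comm : (d1 * d2 = d2 * d1)%g.
  by rewrite !orb_mulE; congr (_, _); rewrite /= !rotv0 addrC.
have := main d2 d1; have := main d1 d2; rewrite -comm !ar => m1 m2.
have : a * (area C [:: 1%g; d1; (d1 * d2)%g] - area C [:: 1%g; d2; (d1 * d2)%g]) = 0.
  by rewrite mulrBr m1 m2; ring.
have -> : area C [:: 1%g; d1; (d1 * d2)%g] - area C [:: 1%g; d2; (d1 * d2)%g] = 2.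
  rewrite orb_mulE /area /cx /cy /ht1 /ht2 /orb_mul rotv0 /=; ring.
by move=> /eqP; rewrite mulf_eq0 pnatr_eq0 orbF => /eqP.
Qed.

End OrbifoldHochschild.

(** * The crossed product and its traces *)

Section Phases.
Variables (R : realType) (theta : R).
Local Notation C := (R[i]).
Local Notation lam := (lam theta).

Lemma lamD s t : lam (s + t) = lam s * lam t.
Proof.
rewrite /Defs.lam mulrDr cosD sinD; apply/eqP; rewrite eq_complex /=.
by rewrite eqxx /= addrC [cos _ * _]mulrC [sin _ * _]mulrC eqxx.
Qed.

Lemma lam0 : lam 0 = 1.
Proof. by rewrite /Defs.lam mulr0 cos0 sin0. Qed.

Lemma lamN s : lam (- s) = (lam s)^-1.
Proof.
have e : lam s * lam (- s) = 1 by rewrite -lamD addrN lam0.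
have s0 : lam s != 0.
  by apply/eqP => s0; move: e; rewrite s0 mul0r => /eqP; rewrite eq_sym oner_eq0.
by apply: (mulfI s0); rewrite e mulfV.
Qed.

Lemma lam_neq0 s : lam s != 0.
Proof.
have e : lam s * lam (- s) = 1 by rewrite -lamD addrN lam0.
by apply/eqP => s0; move: e; rewrite s0 mul0r => /eqP; rewrite eq_sym oner_eq0.
Qed.

Lemma sinDpi_eq0 (x : R) (n : nat) : sin x = 0 -> sin (x + pi *+ n) = 0.
Proof.
move=> sx; elim: n => [|n IHn]; first by rewrite addr0.
by rewrite mulrS addrCA addrC sinDpi IHn oppr0.
Qed.

Lemma sin_pi_eq0 (x : R) : sin (pi * x) = 0 -> exists n : int, x = n%:~R.
Proof.
move=> sx; exists (Num.floor x).
have /andP[xl xr] := floor_itv x.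
set r := x - (Num.floor x)%:~R.
have sr : sin (pi * r) = 0.
  rewrite /r mulrBr; case: (Num.floor x) => n.
    rewrite -[n%:~R]/(n%:R) mulr_natr sinB.
    have := @sinDpi_eq0 0 n (sin0 R); rewrite add0r => ->.
    by rewrite sx mul0r mulr0 subrr.
  rewrite NegzE mulrNz mulrN opprK -[_%:~R]/(n.+1%:R) mulr_natr.
  exact: sinDpi_eq0.
have r0 : 0 <= r by rewrite subr_ge0.
have r1 : r < 1 by rewrite ltrBlDr; move: xr; rewrite intrD addrC.
have [rz|rp] := eqVneq r 0; first by apply/eqP; rewrite -subr_eq0 -/r rz.
have := @sin_gt0_pi R (pi * r); rewrite sr ltxx.
have p0 := pi_gt0 R; have {}r0 : 0 < r by rewrite lt_neqAle eq_sym rp.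
by rewrite mulr_gt0 // gtr_pMr // r1 => /(_ isT).
Qed.

Hypothesis theta_irrational : forall q : rat, theta != ratr q.

Lemma lam_int_eq1 (k : int) : lam k%:~R = 1 -> k = 0.
Proof.
move=> /eqP; rewrite eq_complex /= => /andP[/eqP ck _].
have : sin (pi * (theta * k%:~R)) = 0.
  apply/eqP; rewrite -sqrf_eq0; apply/eqP.
  have e2 : (pi * (theta * k%:~R)) *+ 2 = 2 * pi * theta * k%:~R.
    by rewrite -mulr_natl; ring.
  by have := cos_mulr2n (pi * (theta * k%:~R)); rewrite e2 ck cos2sin2 => h; lra.
move=> /sin_pi_eq0[n nE]; apply/eqP; apply: contraT => k0.
have := theta_irrational (n%:~R / k%:~R); rewrite fmorph_div /= !ratr_int -nE.
by rewrite mulfK ?eqxx // intr_eq0.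
Qed.

Definition phase (k : int) : C := lam (k%:~R / 2).

Lemma phase0 : phase 0 = 1.
Proof. by rewrite /phase mul0r lam0. Qed.

Lemma phaseD k l : phase (k + l) = phase k * phase l.
Proof. by rewrite /phase intrD mulrDl lamD. Qed.

Lemma phase_free k : phase (k + k) = 1 -> k = 0.
Proof.
rewrite /phase intrD -[k%:~R in X in lam X]mulr1 => h; apply: lam_int_eq1; rewrite -h.
by congr (lam _); field.
Qed.

End Phases.

Section CrossedProductTable.
Variables (R : realType) (theta : R) (G : cycsub).
Local Notation C := (R[i]).
Local Notation lam := (lam theta).
Local Notation phase := (phase theta).

(** The triple is W(a, b), whose powers W(za, zb) carry no extra phase; [gU1] and [gU2] are of this
    form. *)
Lemma mpow_weyl (a b z : int) :
  mpow theta (lam ((a * b)%:~R / 2), a, b) z = (lam ((z * z * (a * b))%:~R / 2), z * a, z * b).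
Proof.
have nat_case (a' b' : int) (n : nat) :
    iter n (mmul theta (lam ((a' * b')%:~R / 2), a', b')) (mone R)
    = (lam ((n%:Z * n%:Z * (a' * b'))%:~R / 2), n%:Z * a', n%:Z * b').
  elim: n => [|n IHn]; first by rewrite !mul0r lam0.
  rewrite iterS IHn /mmul -!lamD intS; congr (lam _, _, _); try by ring.
  by rewrite !(intrM, intrD); field.
case: z => n; first exact: nat_case.
rewrite /mpow /minv.
have -> : (lam ((a * b)%:~R / 2))^-1 * lam (a * b)%:~R = lam ((- a * - b)%:~R / 2).
  by rewrite -lamN -lamD; congr (lam _); rewrite !(intrM, intrN); field.
rewrite nat_case NegzE; congr (lam _, _, _); try by ring.
Qed.

Lemma det_rot (j : 'I_(ordm1 G).+1) :
  let '(g11, g12, g21, g22) := matpow (gen G) j in g11 * g22 - g12 * g21 = 1.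
Proof.
have := symp_rotv j e1 e2; rewrite /rotv; case: (matpow _ _) => [[[a b] c] d].
by rewrite /symp /= => h; lia.
Qed.

Lemma act_rot (j : 'I_(ordm1 G).+1) (c d : int) (w := rotv j (c, d)) :
  act theta (matpow (gen G) j) c d = (lam ((w.1 * w.2 - c * d)%:~R / 2), w.1, w.2).
Proof.
rewrite /w /rotv; have := det_rot j; case: (matpow _ _) => [[[g11 g12] g21] g22] det.
rewrite /act /gU1 /gU2 !mpow_weyl /mmul -!lamD /=; congr (lam _, _, _); try by ring.
have -> : (g11 * c + g12 * d) * (g21 * c + g22 * d) - c * d =
   c * c * (g11 * g21) + d * d * (g12 * g22) + 2 * (c * g21 * (d * g12)).
  (* Determinant 1 makes the mixed term exactly twice the exponent that arises from reordering U2
     past U1. *)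
  have -> : c * d = c * d * (g11 * g22 - g12 * g21) by rewrite det mulr1.
  ring.
by rewrite !(intrM, intrD); field.
Qed.

Lemma cpmulE : cpmul theta (G := G) = tmul (@oiota G) (@okap G _ phase).
Proof.
apply/funext => -[[a b] j]; apply/funext => -[[c d] l].
rewrite /cpmul act_rot /mmul /tmul; case E : (rotv j (c, d)) => [p q] /=.
rewrite orb_mulE ext_mulE; congr (_, (_, _)); last first.
  by rewrite /orb_mul /= E.
rewrite mul1r -lamD /okap /phase /ext_mul /orb_mul /= E /symp /=; congr (lam _).
by rewrite !(intrM, intrD, intrB, intrN); field.
Qed.
End CrossedProductTable.

(** * Traces and conjugacy classes *)

Section Traces.
Variables (R : realType) (theta : R) (G : cycsub).
Hypothesis theta_irrational : forall q : rat, theta != ratr q.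
Local Notation C := (R[i]).
Local Notation lam := (lam theta).
Local Notation phase := (phase theta).
Local Notation okap := (@okap G _ phase).
Local Notation b := (hoch_b 1%g (tmul (@oiota G) okap)).
Implicit Types (y s : orb_ext G) (v w : int * int) (j l : 'I_(ordm1 G).+1).

Definition extend (phi : cochain C (orb G)) y : C := okap y * phi [:: opi y].

Lemma hoch_b0E phi (x0 x1 : orb G) : b phi 0 [:: x0; x1] =
  extend phi (oiota x0 * oiota x1)%g - extend phi (oiota x1 * oiota x0)%g.
Proof.
by rewrite /hoch_b big_ord1 expr0 mul1r expr1 mulN1r.
Qed.

Lemma extend_ker phi u y : opi u = 1%g -> extend phi (u * y)%g = okap u * extend phi y.
Proof.
move=> u1; rewrite /extend (okapM (@phaseD _ _)) // opiM u1 mul1g mulrA.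
by [].
Qed.

(** The trace condition is symmetry on products of lifts; central factors come out as scalars, so
    the extension to X is a class function. *)
Lemma extend_conj phi s y : (forall x, size x = 2%N -> b phi 0 x = 0) ->
  extend phi (s * y * s^-1)%g = extend phi y.
Proof.
move=> tr.
have sw (x0 x1 : orb_ext G) : extend phi (x0 * x1)%g = extend phi (x1 * x0)%g.
  have pull (v a u c : orb_ext G) : opi u = 1%g -> (v * a * (u * c) = v * (u * (a * c)))%g.
    by move=> u1; rewrite -mulgA (mulgA a) -(oker_central a u1) -(mulgA u).
  have [u0 u01 ->] := ker_split (@opiM G) (@oiotaK G) (@oiota1 G) x0.
  have [u1 u11 ->] := ker_split (@opiM G) (@oiotaK G) (@oiota1 G) x1.
  rewrite (pull _ _ _ _ u11) (pull _ _ _ _ u01).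
  rewrite 4!(extend_ker phi _ u01, extend_ker phi _ u11) mulrCA; congr (_ * (_ * _)).
  by apply/eqP; rewrite -subr_eq0 -hoch_b0E tr.
by rewrite sw mulKg.
Qed.

(* The exponent is the phase of y relative to W(u) gen^j W(-u), u = (1 - gen^j)^-1 v,
   hence conjugation invariant; for j = 0 the division by 0 leaves just y.1. *)
Definition quad y : C := lam ((y.1%:~R +
  (symp y.2.1 (rotv y.2.2 y.2.1))%:~R / (det1m (matpow (gen G) y.2.2))%:~R) / 2).

Lemma quad_neq0 y : quad y != 0.
Proof. exact: lam_neq0. Qed.

Lemma quad_ker u y : opi u = 1%g -> quad (u * y)%g = okap u * quad y.
Proof.
move=> u1; rewrite oker_mul // (opi_ker u1) /quad /okap /phase /= mulr0 addr0.
by rewrite -lamD; congr (lam _); rewrite intrD -addrA mulrDl.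
Qed.

(** Conjugation by W(w) changes the central coordinate and the quadratic term of [quad] by opposite
    amounts, here with the denominator cleared. *)
Lemma symp_conj j v w : j != 0 ->
  det1m (matpow (gen G) j) * (symp w v - symp (w + v) (rotv j w))
  + symp (w + v - rotv j w) (rotv j (w + v - rotv j w)) = symp v (rotv j v).
Proof.
rewrite /rotv; case: v w => a b [c d].
case: G j => -[[|[|[|[|[|[|j]]]]]] ltj] //= _; rewrite /symp /=; ring.
Qed.

Lemma quad_tz w y : y.2.2 != 0 -> quad (tz G w * y * (tz G w)^-1)%g = quad y.
Proof.
case: y => k [v j] /= j0; rewrite conj_tz /quad /=; congr (lam (_ / 2)).
rewrite -(symp_conj v w j0) [in RHS]intrD [in RHS]intrM [in RHS]mulrDl.
by rewrite mulrAC divff ?intr_eq0 ?det1m_rot // mul1r !(intrD, intrB, intrN); ring.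
Qed.

Lemma conj_rt l k v j : (rt l * (k, (v, j)) * (rt l)^-1)%g = (k, (rotv l v, j)) :> orb_ext G.
Proof.
have -> : ((rt l)^-1 = rt (- l))%g.
  apply: (mulgI (rt l)); rewrite mulgV ext_mulE; congr (_, (_, _)) => /=.
  - by rewrite symp0l addr0.
  - by rewrite rotv_0 addr0.
  - by rewrite addrN.
rewrite !ext_mulE; congr (_, (_, _)) => /=.
- by rewrite rotv_0 symp0l symp0r !addr0 add0r.
- by rewrite add0r rotv_0 addr0.
- by rewrite addrAC addrN add0r.
Qed.

Lemma quad_rt l y : quad (rt l * y * (rt l)^-1)%g = quad y.
Proof.
case: y => k [v j]; rewrite conj_rt /quad /=.
by rewrite -rotvA (addrC j) rotvA symp_rotv.
Qed.

(** A table of conjugacy classes: class i has rotation part [tj i], translation part in [tP i], and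
    representative [tv i]. *)
Variables (d : nat) (tj : 'I_d -> nat) (tP : 'I_d -> int * int -> bool)
  (tv : 'I_d -> int * int).
Hypothesis tj_lt : forall i : 'I_d, (tj i < (ordm1 G).+1)%N.
Hypothesis tP_tz : forall (i : 'I_d) j v w, tj i = j :> nat -> tP i (w + v - rotv j w) = tP i v.
Hypothesis tP_rt : forall (i : 'I_d) l v, tP i (rotv l v) = tP i v.
Hypothesis tP_0 : forall (i : 'I_d) v, tj i = 0%N -> tP i v -> v = 0.
Hypothesis tP_tv : forall i : 'I_d, tP i (tv i).
Hypothesis tP_off : forall i i' : 'I_d, i != i' -> tj i = tj i' -> ~~ tP i (tv i').
(* Nonzero translations carry no trace; everything else is conjugate to a
   representative (tv i, tj i). *)
Hypothesis t_cover : forall j v, (j = 0 /\ v <> 0) \/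
  exists (i : 'I_d) l w, tj i = j :> nat /\ v = w + rotv l (tv i) - rotv j w.

Definition trace_ext (i : 'I_d) y : C :=
  if ((y.2.2 : nat) == tj i) && tP i y.2.1 then quad y else 0.
Definition trace_fun (i : 'I_d) : cochain C (orb G) := fun x =>
  if x is x0 :: _ then trace_ext i (oiota x0) else 0.
Definition trace_repr (i : 'I_d) : orb G := (tv i, inord (tj i)).

Lemma trace_ext_ker i u y : opi u = 1%g -> trace_ext i (u * y)%g = okap u * trace_ext i y.
Proof.
move=> u1; rewrite /trace_ext quad_ker // oker_mul //=.
by case: ifP => // _; rewrite mulr0.
Qed.

Lemma extend_trace_fun i y : extend (trace_fun i) y = trace_ext i y.
Proof.
have [u u1 yE] := ker_split (@opiM G) (@oiotaK G) (@oiota1 G) y.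
rewrite {2}yE trace_ext_ker // /extend /= {1}yE (okapM (@phaseD _ _)) //.
by rewrite (okap_iota (phase0 theta)) mulr1.
Qed.

Lemma trace_ext_conj i s y : trace_ext i (s * y * s^-1)%g = trace_ext i y.
Proof.
case: s => k [w l].
have -> : (k, (w, l)) = (kz G k * tz G w * rt l)%g.
  rewrite (oker_mul (tz G w)) // ext_mulE; congr (_, (_, _)) => /=.
  - by rewrite rotv_0 symp0r !addr0.
  - by rewrite rotv_0 addr0.
  - by rewrite !add0r.
have cM (x x' z : orb_ext G) : (x * x' * z * (x * x')^-1 = x * (x' * z * x'^-1) * x^-1)%g.
  by rewrite invgM !mulgA.
rewrite !cM (oker_central _ (_ : opi (kz G k) = 1%g)) // mulgK.
transitivity (trace_ext i (rt l * y * (rt l)^-1)%g); last first.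
  rewrite /trace_ext quad_rt conj_rot; case: y => k' [v j]; rewrite conj_rt /=.
  by rewrite tP_rt.
case: (_ * y * _)%g => k' [v j]; have [j0|j0] := eqVneq j 0; last first.
  rewrite /trace_ext quad_tz // conj_rot conj_tz /=.
  by case: eqP => //= ej; rewrite tP_tz.
rewrite j0 conj_parabolic trace_ext_ker // /trace_ext /=.
case: ifP => [/andP[/eqP ej Pv]|_]; last by rewrite mulr0.
by rewrite (tP_0 (esym ej) Pv) okap_kz symp0r addr0 phase0 mul1r.
Qed.

Lemma trace_fun_trace i x : size x = 2%N -> b (trace_fun i) 0 x = 0.
Proof.
case: x => [|x0 [|x1 []]] // _; rewrite hoch_b0E !extend_trace_fun.
by rewrite -(trace_ext_conj i (oiota x1)) mulgA mulgK subrr.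
Qed.

Lemma trace_fun_repr i : trace_fun i [:: trace_repr i] != 0.
Proof. by rewrite /= /trace_ext /= inordK // eqxx tP_tv quad_neq0. Qed.

Lemma trace_fun_repr_off i i' : i != i' -> trace_fun i [:: trace_repr i'] = 0.
Proof.
move=> ii'; rewrite /= /trace_ext /= inordK //; case: eqP => //= e.
by rewrite (negPf (tP_off ii' (esym e))).
Qed.

Lemma trace_rep_zero (phi : cochain C (orb G)) :
  (forall x, size x = 2%N -> b phi 0 x = 0) ->
  (forall i : 'I_d, phi [:: trace_repr i] = 0) -> forall x, size x = 1%N -> phi x = 0.
Proof.
move=> tr rep0 [|x []] // _.
suff ext0 y : extend phi y = 0.
  by have := ext0 (oiota x); rewrite /extend (okap_iota (phase0 theta)) mul1r.
case: y => k [v j].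
have [[-> v0]|[i [l [w [ej vE]]]]] := t_cover j v.
  (* Conjugation by W(w) rescales the value at W(v) by [chi2]; a nonzero value would force all these
     phases to be 1, hence v = 0. *)
  apply/eqP; apply: contraT => ne0; case: v0.
  have chi1 w : chi2 phase w v = 1.
    have := extend_conj (tz G w) (k, (v, 0)) tr.
    rewrite conj_parabolic extend_ker // okap_kz -[X in _ = X]mul1r.
    exact: mulIf.
  exact: (chi2_eq1 (phase_free theta_irrational)).
pose y0 : orb_ext G := (0, trace_repr i).
have E0 : extend phi y0 = 0 by rewrite /extend /= rep0 mulr0.
have ji : inord (tj i) = j by apply: val_inj; rewrite /= inordK.
have E1 := extend_conj (tz G w) (rt l * y0 * (rt l)^-1)%g tr.
rewrite (extend_conj (rt l) y0 tr) E0 /y0 /trace_repr conj_rt conj_tz ji -vE in E1.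
set k0 := (_ - _) in E1.
have -> : (k, (v, j)) = (kz G (k - k0) * (k0, (v, j)))%g by rewrite oker_mul //= subrK.
by rewrite extend_ker // E1 mulr0.
Qed.

Lemma orb_HP : HP_isom_Cd (cpunit G) (cpmul theta (G := G)) 0 d.+1 /\
  HP_isom_Cd (cpunit G) (cpmul theta (G := G)) 1 0.
Proof.
rewrite cpmulE.
have mel (x : orb G) : tmul (@oiota G) okap 1%g x = (1, x).
  by rewrite /tmul oiota1 !mul1g (okap_iota (phase0 theta)).
have mer (x : orb G) : tmul (@oiota G) okap x 1%g = (1, x).
  by rewrite /tmul oiota1 !mulg1 (okap_iota (phase0 theta)).
have p0 := phase0 theta; have pD := @phaseD _ theta; have pf := phase_free theta_irrational.
split.
  refine (@HP_even _ (orb G) 1%g (tmul (@oiota G) okap) mel mer (@area_cocycle G _ phase) d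
    trace_fun trace_repr _ _ _ _ _ _ _ _ _).
  - move=> n phi; exact: hoch_vanish_orb.
  - move=> phi; exact: hoch_deg2_orb.
  - move=> x; exact: area_cocycleP.
  - move=> x; exact: conB_area_cocycle.
  - move=> a psi; exact: area_cocycle_nontrivial.
  - exact: trace_fun_trace.
  - exact: trace_fun_repr.
  - exact: trace_fun_repr_off.
  - exact: trace_rep_zero.
apply: (HP_odd mel mer) => n phi; exact: hoch_vanish_orb.
Qed.

End Traces.

(** * Conjugacy class tables of the three groups *)

Lemma rotv_iter_invar (G : cycsub) (P : int * int -> bool) (l : 'I_(ordm1 G).+1) v :
  (forall v, P (mapp (gen G) v) = P v) -> P (rotv l v) = P v.
Proof.
move=> genP; rewrite /rotv mapp_matpow.
by elim: (nat_of_ord l) => // n IHn; rewrite iterS genP.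
Qed.

Definition is_origin (v : int * int) : bool := (v.1 == 0) && (v.2 == 0).

Lemma is_originP v : is_origin v -> v = 0.
Proof. by case: v => a b /andP[/eqP/= -> /eqP/= ->]. Qed.

(** The isomorphism of Z^2 / (1 - omega) Z^2 with Z/3. Here omega acts trivially on the quotient and
    -omega by sign. *)
Definition residue3 (r : int) (v : int * int) : bool := ((v.1 - v.2) %% 3)%Z == r.

Lemma HP_Z3 (R : realType) (theta : R) : (forall q : rat, theta != ratr q) ->
  HP_isom_Cd (cpunit Z3) (cpmul theta (G := Z3)) 0 8 /\
  HP_isom_Cd (cpunit Z3) (cpmul theta (G := Z3)) 1 0.
Proof.
move=> irr.
(* The identity, then det (1 - g) = 3 classes for each of the two rotations. *)
apply: (@orb_HP _ _ Z3 irr 7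
  (fun i => nth 0 [:: 0; 1; 1; 1; 2; 2; 2] i)%N
  (fun i => nth is_origin [:: is_origin; residue3 0; residue3 1; residue3 2;
     residue3 0; residue3 1; residue3 2] i)
  (fun i => nth 0 [:: 0; 0; (1, 0); (2, 0); 0; (1, 0); (2, 0)] i)).
- by case=> -[|[|[|[|[|[|[|i]]]]]]].
- case=> -[|[|[|[|[|[|[|i]]]]]]] lti j [a b] [c d] //=; rewrite /rotv => <-;
  rewrite /is_origin /residue3 /=; lia.
- move=> i l v; apply: rotv_iter_invar => -[a b].
  case: i => -[|[|[|[|[|[|[|i]]]]]]] lti //=; rewrite /is_origin /residue3 /=; lia.
- by case=> -[|[|[|[|[|[|[|i]]]]]]] lti v //= _ /is_originP.
- by case=> -[|[|[|[|[|[|[|i]]]]]]].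
- by case=> -[|[|[|[|[|[|[|i]]]]]]] lti [] [|[|[|[|[|[|[|i']]]]]]].
- case=> -[|[|[|j]]] ltj [a b] //.
  + have [v0|v0] := eqVneq (a, b) 0; last by left; split; [exact: val_inj|exact/eqP].
    right; exists (@Ordinal 7 0 isT), 0, 0; split=> //.
  + right; have : [|| ((a - b) %% 3)%Z == 0, ((a - b) %% 3)%Z == 1 | ((a - b) %% 3)%Z == 2] by lia.
    (* w solves (1 - g) w = v - (r, 0), with r the residue of v. *)
    pose t := - ((a - b) %/ 3)%Z; pose w : int * int := (b - 2 * t, t).
    case/or3P => /eqP r; [exists (@Ordinal 7 1 isT)|exists (@Ordinal 7 2 isT)|
      exists (@Ordinal 7 3 isT)];
    exists 0, w; split=> //; congr (_, _); rewrite /w /t /=; lia.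
  + right; have : [|| ((a - b) %% 3)%Z == 0, ((a - b) %% 3)%Z == 1 | ((a - b) %% 3)%Z == 2] by lia.
    pose t := ((a - b) %/ 3)%Z; pose w : int * int := (t, b + t).
    case/or3P => /eqP r; [exists (@Ordinal 7 4 isT)|exists (@Ordinal 7 5 isT)|
      exists (@Ordinal 7 6 isT)];
    exists 0, w; split=> //; congr (_, _); rewrite /w /t /=; lia.
Qed.

Definition parity_class (r : int) (v : int * int) : bool := ((v.1 + v.2) %% 2)%Z == r.
(** Classes modulo 1 - (-1) = 2, for the rotation by a half turn; those of (1, 0) and (0, 1) are
    exchanged by the quarter turn. *)
Definition residue2 (r : int) (v : int * int) : bool :=
  ((v.1 %% 2)%Z == r) && ((v.2 %% 2)%Z == r).

Lemma HP_Z4 (R : realType) (theta : R) : (forall q : rat, theta != ratr q) ->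
  HP_isom_Cd (cpunit Z4) (cpmul theta (G := Z4)) 0 9 /\
  HP_isom_Cd (cpunit Z4) (cpmul theta (G := Z4)) 1 0.
Proof.
move=> irr.
(* Determinants 2, 4, 2. At j = 2 the odd [parity_class] is the union of the two exchanged classes,
   so three classes remain there. *)
apply: (@orb_HP _ _ Z4 irr 8
  (fun i => nth 0 [:: 0; 1; 1; 2; 2; 2; 3; 3] i)%N
  (fun i => nth is_origin
     [:: is_origin; parity_class 0; parity_class 1; residue2 0; residue2 1; parity_class 1;
         parity_class 0; parity_class 1] i)
  (fun i => nth 0 [:: 0; 0; (1, 0); 0; (1, 1); (1, 0); 0; (1, 0)] i)).
- by case=> -[|[|[|[|[|[|[|[|i]]]]]]]].
- case=> -[|[|[|[|[|[|[|[|i]]]]]]]] lti j [a b] [c d] //=; rewrite /rotv => <-;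
  rewrite /is_origin /parity_class /residue2 /=; lia.
- move=> i l v; apply: rotv_iter_invar => -[a b].
  case: i => -[|[|[|[|[|[|[|[|i]]]]]]]] lti //=; rewrite /is_origin /parity_class /residue2 /=; lia.
- by case=> -[|[|[|[|[|[|[|[|i]]]]]]]] lti v //= _ /is_originP.
- by case=> -[|[|[|[|[|[|[|[|i]]]]]]]].
- by case=> -[|[|[|[|[|[|[|[|i]]]]]]]] lti [] [|[|[|[|[|[|[|[|i']]]]]]]].
- case=> -[|[|[|[|j]]]] ltj [a b] //.
  + have [v0|v0] := eqVneq (a, b) 0; last by left; split; [exact: val_inj|exact/eqP].
    by right; exists (@Ordinal 8 0 isT), 0, 0.
  + right; have : ((a + b) %% 2)%Z == 0 \/ ((a + b) %% 2)%Z == 1 by lia.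
    pose t := ((a + b) %/ 2)%Z; pose w : int * int := (t, b - t).
    case=> /eqP r; [exists (@Ordinal 8 1 isT)|exists (@Ordinal 8 2 isT)];
    exists 0, w; split=> //; congr (_, _); rewrite /w /t /=; lia.
  + right; pose w : int * int := ((a %/ 2)%Z, (b %/ 2)%Z).
    have : ((a %% 2)%Z = 0 /\ (b %% 2)%Z = 0 \/ (a %% 2)%Z = 1 /\ (b %% 2)%Z = 1) \/
      ((a %% 2)%Z = 1 /\ (b %% 2)%Z = 0 \/ (a %% 2)%Z = 0 /\ (b %% 2)%Z = 1) by lia.
    (* The last case uses the quarter turn, which sends (1, 0) to (0, -1); hence the shift b + 1. *)
    case=> -[] [ra rb]; [exists (@Ordinal 8 3 isT), 0, w|exists (@Ordinal 8 4 isT), 0, w|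
      exists (@Ordinal 8 5 isT), 0, w|
      exists (@Ordinal 8 5 isT), (@Ordinal 4 1 isT), (w.1, ((b + 1) %/ 2)%Z)];
    split=> //; congr (_, _); rewrite /w /=; lia.
  + right; have : ((a + b) %% 2)%Z == 0 \/ ((a + b) %% 2)%Z == 1 by lia.
    pose t := ((a + b) %/ 2)%Z; pose w : int * int := (t - b, t).
    case=> /eqP r; [exists (@Ordinal 8 6 isT)|exists (@Ordinal 8 7 isT)];
    exists 0, w; split=> //; congr (_, _); rewrite /w /t /=; lia.
Qed.

Lemma HP_Z6 (R : realType) (theta : R) : (forall q : rat, theta != ratr q) ->
  HP_isom_Cd (cpunit Z6) (cpmul theta (G := Z6)) 0 10 /\
  HP_isom_Cd (cpunit Z6) (cpmul theta (G := Z6)) 1 0.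
Proof.
move=> irr.
(* Determinants 1, 3, 4, 3, 1. Rotations merge the nonzero classes: the two modulo 1 - g at j = 2
   and 4, and the three modulo 2 at j = 3. *)
apply: (@orb_HP _ _ Z6 irr 9
  (fun i => nth 0 [:: 0; 1; 2; 2; 3; 3; 4; 4; 5] i)%N
  (fun i => nth is_origin [:: is_origin; xpredT; residue3 0; xpredC (residue3 0); residue2 0;
     xpredC (residue2 0); residue3 0; xpredC (residue3 0); xpredT] i)
  (fun i => nth 0 [:: 0; 0; 0; (1, 0); 0; (1, 0); 0; (1, 0); 0] i)).
- by case=> -[|[|[|[|[|[|[|[|[|i]]]]]]]]].
- case=> -[|[|[|[|[|[|[|[|[|i]]]]]]]]] lti j [a b] [c d] //=; rewrite /rotv => <-;
  rewrite /is_origin /residue3 /residue2 /=; lia.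
- move=> i l v; apply: rotv_iter_invar => -[a b].
  case: i => -[|[|[|[|[|[|[|[|[|i]]]]]]]]] lti //=; rewrite /is_origin /residue3 /residue2 /=; lia.
- by case=> -[|[|[|[|[|[|[|[|[|i]]]]]]]]] lti v //= _ /is_originP.
- by case=> -[|[|[|[|[|[|[|[|[|i]]]]]]]]].
- by case=> -[|[|[|[|[|[|[|[|[|i]]]]]]]]] lti [] [|[|[|[|[|[|[|[|[|i']]]]]]]]].
- case=> -[|[|[|[|[|[|j]]]]]] ltj [a b] //.
  + have [v0|v0] := eqVneq (a, b) 0; last by left; split; [exact: val_inj|exact/eqP].
    by right; exists (@Ordinal 9 0 isT), 0, 0.
  + right; exists (@Ordinal 9 1 isT), 0, (- b, a + b).
    by split=> //; congr (_, _) => /=; lia.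
  + right; pose t := ((a - b) %/ 3)%Z; pose t' := ((a - b + 1) %/ 3)%Z.
    have : ((a - b) %% 3)%Z = 0 \/ ((a - b) %% 3)%Z = 1 \/ ((a - b) %% 3)%Z = 2 by lia.
    case=> [r|[r|r]]; [exists (@Ordinal 9 2 isT), 0, (t, b + t)|
      exists (@Ordinal 9 3 isT), 0, (t, b + t)|
      exists (@Ordinal 9 3 isT), (@Ordinal 6 1 isT), (t', b - 1 + t')];
    split=> //; congr (_, _); rewrite /t /t' /=; lia.
  + right; pose w : int * int := ((a %/ 2)%Z, (b %/ 2)%Z).
    have : ((a %% 2)%Z = 0 /\ (b %% 2)%Z = 0 \/ (a %% 2)%Z = 1 /\ (b %% 2)%Z = 0) \/
      ((a %% 2)%Z = 0 /\ (b %% 2)%Z = 1 \/ (a %% 2)%Z = 1 /\ (b %% 2)%Z = 1) by lia.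
    (* The nonzero classes modulo 2 are reached from (1, 0) by gen^0, gen and gen^2, that is as (1,
       0), (0, 1) and (-1, 1); hence the shift a + 1. *)
    case=> -[] [ra rb]; [exists (@Ordinal 9 4 isT), 0, w|exists (@Ordinal 9 5 isT), 0, w|
      exists (@Ordinal 9 5 isT), (@Ordinal 6 1 isT), w|
      exists (@Ordinal 9 5 isT), (@Ordinal 6 2 isT), (((a + 1) %/ 2)%Z, w.2)];
    split=> //; congr (_, _); rewrite /w /=; lia.
  + right; pose t := - ((a - b) %/ 3)%Z; pose t' := - ((a - b + 1) %/ 3)%Z.
    have : ((a - b) %% 3)%Z = 0 \/ ((a - b) %% 3)%Z = 1 \/ ((a - b) %% 3)%Z = 2 by lia.
    case=> [r|[r|r]]; [exists (@Ordinal 9 6 isT), 0, (b - 2 * t, t)|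
      exists (@Ordinal 9 7 isT), 0, (b - 2 * t, t)|
      exists (@Ordinal 9 7 isT), (@Ordinal 6 1 isT), (a + t', t')];
    split=> //; congr (_, _); rewrite /t /t' /=; lia.
  + right; exists (@Ordinal 9 8 isT), 0, (a + b, - a).
    by split=> //; congr (_, _) => /=; lia.
Qed.

Theorem theorem2p2 (R : realType) (theta : R) :
  (forall q : rat, theta != ratr q) ->
  [/\ HP_isom_Cd (cpunit Z3) (cpmul theta (G:=Z3)) 0 8,
      HP_isom_Cd (cpunit Z4) (cpmul theta (G:=Z4)) 0 9,
      HP_isom_Cd (cpunit Z6) (cpmul theta (G:=Z6)) 0 10 &
      forall G : cycsub, HP_isom_Cd (cpunit G) (cpmul theta (G:=G)) 1 0].
Proof.
move=> irr; have [e3 o3] := HP_Z3 irr; have [e4 o4] := HP_Z4 irr.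
by have [e6 o6] := HP_Z6 irr; split=> // -[].
Qed.
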